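(* Suppose that $\mathcal{A}$ is a von Neumann algebra and $S$ is an admissible collection of weakly continuous linear symmetry maps on $\mathcal{A}$ so that $(\mathcal{A},S)$ has TR rank 1. Let $\epsilon_\ell$ be the function described in the context. Let $\phi$ be a weakly continuous conjugate-linear symmetry map on $\mathcal{A}$ with order 2 that commutes with every symmetry map in $S$. (Resp. let $\varphi$ be a weakly continuous linear symmetry map on $\mathcal{A}$ with order 2 that commutes with every symmetry map in $S$.) Then if $A\in\mathcal{A}$ is an $S\cup\{\phi\}$-symmetric (resp. $S$-symmetric and $\varphi$-antisymmetric) contraction, there is a normal $A''\in\mathcal{A}$ that is $S\cup\{\phi\}$-symmetric (resp. $S$-symmetric and $\varphi$-antisymmetric) and satisfies $$\|A''-A\|\le90\sqrt{\epsilon_\ell\left(\|[A^*,A]\|\right)}.$$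
   Context: ''Linear'' means $\mathbb{C}$-linear. A symmetry map on a unital $C^*$-algebra $\mathcal{A}$ is an $\mathbb{R}$-linear map $\varphi:\mathcal{A}\to\mathcal{A}$ that is hermitian ($\varphi(A^* )=\varphi(A)^*$), maps non-invertible elements to non-invertible elements, satisfies $\varphi(I)=I$, is linear or conjugate-linear ($\varphi(cA)=\overline{c}\varphi(A)$), and is multiplicative or anti-multiplicative ($\varphi(AB)=\varphi(B)\varphi(A)$). Its type is the combination linear/conjugate-linear and multiplicative/anti-multiplicative. $\varphi$ has order $2$ if $\varphi^2=\mathrm{id}\neq\varphi$. $A$ is $\varphi$-symmetric if $\varphi(A)=A$, $\varphi$-antisymmetric if $\varphi(A)=-A$, and $S$-symmetric if $\varphi(A)=A$ for all $\varphi\in S$; $\mathcal{A}_S$ is the set of $S$-symmetric elements. ''Weakly continuous'' refers to the weak operator topology. A contraction is an element of norm at most $1$. $(\mathcal{A},S)$ has TR rank 1 if the invertible elements of $\mathcal{A}_S$ are dense in $\mathcal{A}_S$. $S$ is admissible if for each type of symmetry map occurring in $S$ other than linear multiplicative, there is a symmetry map in $S$ of that type that commutes with every symmetry map in $S$. $\epsilon_\ell=\max(\epsilon_1,\epsilon_2)$, where $\epsilon_1$ (Friis–Rørdam) and $\epsilon_2$ (Loring–Sørensen) are fixed monotonically increasing functions with $\lim_{\delta\to0}\epsilon_i(\delta)=0$ such that: (1) for every unital $C^*$-algebra $\mathcal{B}$ with stable rank 1 and every contraction $A\in\mathcal{B}$, there is a normal $A'\in\mathcal{B}$ with $\|A'-A\|\le\epsilon_1(\|[A^*,A]\|)$;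 (2) for every unital $C^*$-algebra $\mathcal{B}$ and every linear anti-multiplicative symmetry map $\tau$ on $\mathcal{B}$ of order $2$ such that $(\mathcal{B},\{\tau\})$ has TR rank 1, and every $\tau$-symmetric contraction $A\in\mathcal{B}$, there is a normal $\tau$-symmetric $A'\in\mathcal{B}$ with $\|A'-A\|\le\epsilon_2(\|[A^*,A]\|)$. *)

(* Defs.v *)
From HB Require Import structures.
From mathcomp Require Import all_boot all_order all_algebra.
From mathcomp Require Import complex.
From mathcomp Require Import all_classical all_reals all_analysis.

Set Implicit Arguments.
Unset Strict Implicit.
Unset Printing Implicit Defensive.

Import Order.TTheory GRing.Theory Num.Theory.
Import numFieldNormedType.Exports.

Local Open Scope classical_set_scope.
Local Open Scope ring_scope.

(** * Unital C*-algebras *)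

(* MathComp-Analysis has no structure that is both a ring and a normed module
   (other than its number fields), so the norm, which is real-valued here, and
   the completeness are fields of the mixin.  Every [algType] satisfies
   [1 != 0], hence the zero algebra is excluded. *)
HB.mixin Record isCStarAlgebra (R : realType) A of GRing.Algebra R[i] A := {
  star : A -> A;
  starD : forall a b, star (a + b) = star a + star b;
  starZ : forall (c : R[i]) a, star (c *: a) = c^* *: star a;
  starM : forall a b, star (a * b) = star b * star a;
  starK : forall a, star (star a) = a;
  cnorm : A -> R;
  cnormD_le : forall a b, cnorm (a + b) <= cnorm a + cnorm b;
  cnormZ : forall (c : R[i]) a, cnorm (c *: a) = complex.Re `|c| * cnorm a;
  cnorm_eq0 : forall a, cnorm a = 0 -> a = 0;
  cnormM_le : forall a b, cnorm (a * b) <= cnorm a * cnorm b;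
  cnorm_star_mul : forall a, cnorm (star a * a) = cnorm a ^+ 2;
  cnorm_complete : forall u : nat -> A,
    (forall e : R, 0 < e -> exists N : nat,
       forall m n, (N <= m)%N -> (N <= n)%N -> cnorm (u m - u n) < e) ->
    exists l : A, cnorm (u n - l) @[n --> \oo] --> (0 : R)
}.

#[short(type="cstarAlgType")]
HB.structure Definition CStarAlgebra (R : realType) :=
  { A of GRing.Algebra R[i] A & isCStarAlgebra R A }.

Section CStarAlgebraNotions.
Variables (R : realType) (A : cstarAlgType R).
Implicit Types (a b : A) (phi psi : A -> A) (S : set (A -> A)).

Definition invertible a : Prop := exists b, a * b = 1 /\ b * a = 1.

Definition is_normal a : Prop := star a * a = a * star a.

Definition norm_contraction a : Prop := cnorm a <= 1.

(* [X] is contained in the norm closure of [Y] *)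
Definition norm_dense_in (Y X : set A) : Prop :=
  forall a, X a -> forall e : R, 0 < e -> exists2 b, Y b & cnorm (b - a) < e.

Definition stable_rank1 : Prop := norm_dense_in [set a | invertible a] setT.

(** ** Symmetry maps *)

Definition clinear phi : Prop := forall (c : R[i]) a, phi (c *: a) = c *: phi a.

Definition conjugate_linear phi : Prop :=
  forall (c : R[i]) a, phi (c *: a) = c^* *: phi a.

Definition multiplicative_map phi : Prop :=
  forall a b, phi (a * b) = phi a * phi b.

Definition antimultiplicative_map phi : Prop :=
  forall a b, phi (a * b) = phi b * phi a.

Record symmetry_map phi : Prop := SymmetryMap {
  symmetry_add : forall a b, phi (a + b) = phi a + phi b;
  symmetry_scale_real :
    forall (r : R) a, phi ((r%:C)%C *: a) = (r%:C)%C *: phi a;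
  symmetry_star : forall a, phi (star a) = star (phi a);
  symmetry_noninvertible : forall a, ~ invertible a -> ~ invertible (phi a);
  symmetry_one : phi 1 = 1;
  symmetry_linear : clinear phi \/ conjugate_linear phi;
  symmetry_mul : multiplicative_map phi \/ antimultiplicative_map phi
}.

(* First component: linear or conjugate-linear; second component:
   multiplicative or anti-multiplicative. *)
Definition has_type (t : bool * bool) phi : Prop :=
  (if t.1 then clinear phi else conjugate_linear phi) /\
  (if t.2 then multiplicative_map phi else antimultiplicative_map phi).

Definition commuting_maps phi psi : Prop :=
  forall a, phi (psi a) = psi (phi a).

Definition order_two phi : Prop :=
  (forall a, phi (phi a) = a) /\ (exists a, phi a <> a).

Definition symmetric_elements S : set A :=
  [set a | forall phi, S phi -> phi a = a].

Definition antisymmetric_element phi a : Prop := phi a = - a.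

Definition TR_rank1 S : Prop :=
  norm_dense_in (symmetric_elements S `&` [set a | invertible a])
                (symmetric_elements S).

Definition admissible S : Prop :=
  forall (t : bool * bool) phi, t <> (true, true) -> S phi -> has_type t phi ->
  exists psi, [/\ S psi, has_type t psi &
                  forall chi, S chi -> commuting_maps psi chi].

End CStarAlgebraNotions.

Arguments stable_rank1 {R} A.

(** * Von Neumann algebras *)

(* The inner product is linear in its first argument. *)
HB.mixin Record isHilbert (R : realType) H of CompleteNormedModule R[i] H := {
  dotp : {dot H for (@Num.conj R[i])};
  norm_dotp : forall x : H, `|x| ^+ 2 = dotp x x
}.

#[short(type="hilbertType")]
HB.structure Definition Hilbert (R : realType) :=
  { H of CompleteNormedModule R[i] H & isHilbert R H }.

Section Operators.
Variables (R : realType) (H : hilbertType R).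

Definition bounded_operator (T : H -> H) : Prop := linear T /\ continuous T.

Definition operator_norm (T : H -> H) : R :=
  sup [set complex.Re `|T x| | x in [set x : H | `|x| <= 1]].

(* all the matrix coefficients of [T], with the topology of pointwise
   convergence *)
Definition matrix_coefficients (T : H -> H) : {ptws H * H -> R[i]^o} :=
  fun xy => dotp (T xy.1) xy.2.

(* the weak operator topology *)
Definition wot : topologicalType := initial_topology matrix_coefficients.

End Operators.

(* An algebra of operators on [vn_space], presented by its carrier [vn_alg]
   and the inclusion [vn_op] of [vn_alg] in the bounded operators. *)
Record vonNeumannAlgebra (R : realType) := VonNeumannAlgebra {
  vn_alg :> cstarAlgType R;
  vn_space : hilbertType R;
  vn_op : vn_alg -> vn_space -> vn_space;
  vn_op_bounded : forall a, bounded_operator (vn_op a);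
  vn_opD : forall a b x, vn_op (a + b) x = vn_op a x + vn_op b x;
  vn_opZ : forall (c : R[i]) a x, vn_op (c *: a) x = c *: vn_op a x;
  vn_opM : forall a b x, vn_op (a * b) x = vn_op a (vn_op b x);
  vn_op1 : forall x, vn_op 1 x = x;
  vn_op_star : forall a x y, dotp (vn_op (star a) x) y = dotp x (vn_op a y);
  vn_op_norm : forall a, cnorm a = operator_norm (vn_op a);
  vn_wot_closed : forall T : vn_space -> vn_space, bounded_operator T ->
    closure (range vn_op : set (wot vn_space)) T -> range vn_op T
}.

Section WeakContinuity.
Variables (R : realType) (A : vonNeumannAlgebra R).

(* the topology induced on the algebra by the weak operator topology *)
Definition vn_wot : topologicalType :=
  initial_topology (@vn_op R A : A -> wot (vn_space A)).

Definition weakly_continuous (phi : A -> A) : Prop :=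
  continuous (phi : vn_wot -> vn_wot).

End WeakContinuity.

(** * Control functions *)

Section ControlFunctions.
Variable R : realType.
Implicit Types eps : R -> R.

(* Only the values on nonnegative reals matter. *)
Definition control_function eps : Prop :=
  {in Num.nneg &, {homo eps : x y / x <= y}} /\
  eps x @[x --> 0^'+] --> (0 : R).

Definition comm_norm (A : cstarAlgType R) (a : A) : R :=
  cnorm (star a * a - a * star a).

Definition FriisRordam eps : Prop :=
  forall (B : cstarAlgType R), stable_rank1 B ->
  forall a : B, norm_contraction a ->
  exists a' : B, is_normal a' /\ cnorm (a' - a) <= eps (comm_norm a).

Definition LoringSorensen eps : Prop :=
  forall (B : cstarAlgType R) (tau : B -> B),
  symmetry_map tau -> clinear tau -> antimultiplicative_map tau ->
  order_two tau -> TR_rank1 [set tau] ->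
  forall a : B, norm_contraction a -> tau a = a ->
  exists a' : B, [/\ is_normal a', tau a' = a' &
                     cnorm (a' - a) <= eps (comm_norm a)].

End ControlFunctions.

(* Main.v *)
Require Import Defs.
From HB Require Import structures.
From mathcomp Require Import all_boot all_order all_algebra.
From mathcomp Require Import complex.
From mathcomp Require Import all_classical all_reals all_analysis.
From mathcomp Require Import ring lra.
From Stdlib Require Ncring Ncring_tac.

Set Implicit Arguments.
Unset Strict Implicit.
Unset Printing Implicit Defensive.

Import Order.TTheory GRing.Theory Num.Theory.
Import numFieldNormedType.Exports.

Local Open Scope classical_set_scope.
Local Open Scope ring_scope.

(** Multiplication by [i] turns an element fixed by a conjugate-linear symmetry
    map into one that this map negates.  Both halves of the theorem therefore
    concern an [S]-symmetric contraction [b] with [phi b = - b], where [phi] is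
    real-linear, and ask for a normal element near [b] with the same symmetries.

    A normal [S]-symmetric [N] near [b], say within [e], comes from the two control
    functions ([normal_approx]).  If all maps in [S] are multiplicative, the
    [S]-symmetric elements form a C*-algebra of stable rank one.  Otherwise
    admissibility provides an anti-multiplicative [psi0] in [S] that commutes with
    [S], and the [S]-symmetric elements are those fixed by the involution that
    [psi0] induces on a suitable C*-subalgebra.

    It remains to make [N] antisymmetric.  As [phi N] is within [2 * e] of [- N],
    the spectral picture of [N] is nearly symmetric about the imaginary axis.  Let
    [E] be the spectral projection of the real part of [N] above [t := sqrt e], and
    [F := phi E].  These belong to nearly opposite operators and to half-lines that
    are [2 * t] apart, so [E * F] has norm at most [e / t = t]
    ([almost_orthogonal]); balancing the gap against this quotient is where the
    square root comes from.  The spectral projection [Q] of [E - F] above [1/2] is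
    close to [E] and exactly orthogonal to [phi Q] ([near_projection],
    [spp_opp_orth]), and a reflection [U] exchanges [E] and [Q] ([swap]).  With
    [m := U E N E U] and [K := 1 - Q - phi Q], the element
    [m - phi m + K (b - star b) / 2 K] is normal, since its three terms are normal
    and live on orthogonal subspaces; it is antisymmetric by construction; and it
    is close to [b], because the real part of [b] is of order [t] on the range of
    [K] ([antisym_normal]).

    The functional calculus needed is reduced to one function, the sign of a
    self-adjoint contraction ([sgn]), obtained as the strong limit of an explicit
    sequence of odd real polynomials.  It yields the spectral projections and the
    reflection.  Being a weak limit of real polynomials, it commutes with every
    weakly continuous symmetry map, linear or not, multiplicative or not.  Such
    maps are also contractive ([sym_norm_le]), which lets [phi] transport
    estimates. *)

(** * The real inner product of a complex Hilbert space *)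

Section RealHilbert.
Variables (R : realType) (H : hilbertType R).
Implicit Types x y z : H.

Definition rip x y : R := complex.Re (dotp x y).
Definition hnorm x : R := complex.Re `|x|.

Lemma hnormE x : `|x| = ((hnorm x)%:C)%C.
Proof. by apply/esym/RRe_real/ger0_real. Qed.

Lemma hnorm_ge0 x : 0 <= hnorm x.
Proof. by rewrite -lecR -hnormE normr_ge0. Qed.

Lemma hnorm_eq0 x : hnorm x = 0 -> x = 0.
Proof. by move=> h; apply/normr0_eq0; rewrite hnormE h. Qed.

Lemma hnorm_triangle x y : hnorm (x + y) <= hnorm x + hnorm y.
Proof. by rewrite -lecR rmorphD /= -!hnormE ler_normD. Qed.

Lemma hnormZ (c : R[i]) x : hnorm (c *: x) = complex.Re `|c| * hnorm x.
Proof.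
apply: complexI; rewrite -hnormE normrZ hnormE [in RHS]rmorphM /=.
by rewrite RRe_real // normr_real.
Qed.

Lemma hnorm_sq x : hnorm x ^+ 2 = rip x x.
Proof. by rewrite /rip -norm_dotp hnormE -rmorphXn. Qed.

Lemma ripDl x y z : rip (x + y) z = rip x z + rip y z.
Proof. by rewrite /rip linearDl raddfD. Qed.

Lemma dotpC x y : dotp x y = (dotp y x)^*%R.
Proof. by have := hermC dotp x y; rewrite expr0 mul1r. Qed.

Lemma ripC x y : rip x y = rip y x.
Proof. by rewrite /rip dotpC; case: (dotp y x). Qed.

Lemma ripDr x y z : rip x (y + z) = rip x y + rip x z.
Proof. by rewrite ripC ripDl !(ripC _ x). Qed.

Lemma ripZl (r : R) x y : rip ((r%:C)%C *: x) y = r * rip x y.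
Proof. by rewrite /rip linearZl_LR /=; case: (dotp x y) => a b /=; rewrite mul0r subr0. Qed.

Lemma ripZr (r : R) x y : rip x ((r%:C)%C *: y) = r * rip x y.
Proof. by rewrite ripC ripZl ripC. Qed.

Lemma ripNl x y : rip (- x) y = - rip x y.
Proof. by rewrite /rip linearNl raddfN. Qed.

Lemma ripNr x y : rip x (- y) = - rip x y.
Proof. by rewrite ripC ripNl ripC. Qed.

Lemma ripBl x y z : rip (x - y) z = rip x z - rip y z.
Proof. by rewrite ripDl ripNl. Qed.

Lemma ripBr x y z : rip x (y - z) = rip x y - rip x z.
Proof. by rewrite ripDr ripNr. Qed.

Lemma rip_ge0 x : 0 <= rip x x.
Proof. by rewrite -hnorm_sq sqr_ge0. Qed.

Lemma hnorm0 : hnorm 0 = 0.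
Proof. by rewrite /hnorm normr0. Qed.

Lemma hnorm_opp x : hnorm (- x) = hnorm x.
Proof. by rewrite /hnorm normrN. Qed.

Lemma hnormZr (r : R) x : hnorm ((r%:C)%C *: x) = `|r| * hnorm x.
Proof. by rewrite hnormZ normc_def /= expr0n addr0 sqrtr_sqr. Qed.

Lemma rip0l y : rip 0 y = 0.
Proof. by rewrite /rip linear0l. Qed.

Lemma rip_CS x y : rip x y <= hnorm x * hnorm y.
Proof.
have [->|x0] := eqVneq x 0; first by rewrite rip0l hnorm0 mul0r.
have hx : 0 < hnorm x.
  rewrite lt_neqAle hnorm_ge0 andbT eq_sym.
  by apply: contra_neq x0; exact: hnorm_eq0.
have := rip_ge0 (((rip x y)%:C)%C *: x - ((hnorm x ^+ 2)%:C)%C *: y).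
rewrite !ripBl !ripBr !ripZl !ripZr -!hnorm_sq (ripC y x) => h.
have : 0 <= hnorm x ^+ 2 * (hnorm x ^+ 2 * hnorm y ^+ 2 - rip x y ^+ 2).
  by apply: le_trans h _; rewrite le_eqVlt; apply/orP; left; apply/eqP; ring.
rewrite pmulr_rge0 ?exprn_gt0 // subr_ge0 -exprMn => h2.
have [r0|r0] := leP (rip x y) 0.
  by apply: le_trans r0 _; rewrite mulr_ge0 ?hnorm_ge0.
by rewrite -(@ler_pXn2r _ 2) ?nnegrE ?mulr_ge0 ?hnorm_ge0 // ltW.
Qed.

Lemma rip_CS_abs x y : `|rip x y| <= hnorm x * hnorm y.
Proof.
rewrite ler_norml rip_CS andbT lerNl -ripNl -(hnorm_opp x).
exact: rip_CS.
Qed.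

Lemma hnorm_sqD x y : hnorm (x + y) ^+ 2 = hnorm x ^+ 2 + 2 * rip x y + hnorm y ^+ 2.
Proof. rewrite !hnorm_sq ripDl !ripDr (ripC y x); ring. Qed.

Lemma hnorm_sqB x y : hnorm (x - y) ^+ 2 = hnorm x ^+ 2 - 2 * rip x y + hnorm y ^+ 2.
Proof. by rewrite hnorm_sqD hnorm_opp ripNr mulrN. Qed.

(** The imaginary part of the inner product is again a real inner product,
    so weak convergence may be tested on real inner products alone. *)
Lemma dotp_rip x y : dotp x y = ((rip x y) +i* (rip x ('i%C *: y)))%C.
Proof.
rewrite /rip linearZr_LR /=; case: (dotp x y) => a b /=.
by congr (_ +i* _)%C; ring.
Qed.

End RealHilbert.

(** * Norm and involution of a C*-algebra *)

Section CStar.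
Variables (R : realType) (A : cstarAlgType R).
Implicit Types a b : A.

Lemma star0 : star (0 : A) = 0.
Proof. by have := starZ (0 : R[i]) (0 : A); rewrite rmorph0 !scale0r. Qed.

Lemma starN a : star (- a) = - star a.
Proof. by rewrite -scaleN1r starZ rmorphN rmorph1 scaleN1r. Qed.

Lemma starB a b : star (a - b) = star a - star b.
Proof. by rewrite starD starN. Qed.

Lemma starZr (r : R) a : star ((r%:C)%C *: a) = (r%:C)%C *: star a.
Proof. by rewrite starZ; congr (_ *: _); exact: conjc_real. Qed.

Lemma star1 : star (1 : A) = 1.
Proof.
have h : star (1 : A) * 1 = 1 by rewrite -[X in _ * X](starK 1) -starM mulr1 starK.
by rewrite mulr1 in h.
Qed.

Lemma cnormZr (r : R) a : cnorm ((r%:C)%C *: a) = `|r| * cnorm a.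
Proof. by rewrite cnormZ normc_def /= expr0n addr0 sqrtr_sqr. Qed.

Lemma cnorm0 : cnorm (0 : A) = 0.
Proof. by have := cnormZr 0 0; rewrite scaler0 normr0 mul0r. Qed.

Lemma cnormN a : cnorm (- a) = cnorm a.
Proof. by have := cnormZr (-1) a; rewrite normrN1 mul1r rmorphN1 scaleN1r. Qed.

Lemma cnorm_ge0 a : 0 <= cnorm a.
Proof.
have := cnormD_le a (- a); rewrite subrr cnorm0 cnormN -mulr2n.
by rewrite pmulrn_lge0.
Qed.

Lemma cnormB_le a b : cnorm (a - b) <= cnorm a + cnorm b.
Proof. by rewrite -(cnormN b) cnormD_le. Qed.

Lemma cnormBC a b : cnorm (a - b) = cnorm (b - a).
Proof. by rewrite -opprB cnormN. Qed.

Lemma cnorm_gt0 a : a != 0 -> 0 < cnorm a.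
Proof.
move=> a0; rewrite lt_neqAle cnorm_ge0 andbT eq_sym.
by apply: contra_neq a0; exact: cnorm_eq0.
Qed.

Lemma cnorm_star a : cnorm (star a) = cnorm a.
Proof.
have le b : cnorm b <= cnorm (star b).
  have [->|b0] := eqVneq b 0; first by rewrite star0.
  rewrite -(ler_pM2r (cnorm_gt0 b0)) -expr2 -cnorm_star_mul; exact: cnormM_le.
by apply/eqP; rewrite eq_le le andbT -{2}(starK a) le.
Qed.

Lemma cnorm_mul_star a : cnorm (a * star a) = cnorm a ^+ 2.
Proof. by rewrite -{1}(starK a) cnorm_star_mul cnorm_star. Qed.

End CStar.

(** The weak topologies at hand are initial topologies; this turns convergence in
    them into convergence of images. *)
Lemma initial_cvgP (U : choiceType) (V : topologicalType) (f : U -> V)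
    (F : set_system (initial_topology f)) (s : initial_topology f) :
  Filter F -> F --> s <-> f @ F --> f s.
Proof.
move=> FF; split=> [Fs|Fs B].
  by apply: cvg_comp Fs _; exact: (@initial_continuous _ _ f).
rewrite nbhsE => -[_ [[C Cop <-] Cs] CB].
by apply: filterS CB _; apply: Fs; exact: open_nbhs_nbhs.
Qed.

(** * Operators of a von Neumann algebra and weak convergence *)

Section Operators.
Variables (R : realType) (A : vonNeumannAlgebra R).
Local Notation H := (vn_space A).
Implicit Types (a b : A) (x y : H).

Lemma opZr (r : R) a x : vn_op ((r%:C)%C *: a) x = (r%:C)%C *: vn_op a x.
Proof. exact: vn_opZ. Qed.

Lemma opN a x : vn_op (- a) x = - vn_op a x.
Proof. by rewrite -scaleN1r vn_opZ scaleN1r. Qed.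

Lemma opB a b x : vn_op (a - b) x = vn_op a x - vn_op b x.
Proof. by rewrite vn_opD opN. Qed.

Lemma op0 x : vn_op (0 : A) x = 0.
Proof. by have := vn_opZ (0 : R[i]) (0 : A) x; rewrite !scale0r. Qed.

Lemma op_lin a : linear (vn_op a).
Proof. by have [] := vn_op_bounded a. Qed.

Lemma op_additive a x y : vn_op a (x + y) = vn_op a x + vn_op a y.
Proof. by have := op_lin a 1 x y; rewrite !scale1r. Qed.

Lemma op_scale a (c : R[i]) x : vn_op a (c *: x) = c *: vn_op a x.
Proof.
have h0 : vn_op a 0 = 0.
  by apply: (addrI (vn_op a 0)); rewrite -op_additive !addr0.
by have := op_lin a c x 0; rewrite h0 !addr0.
Qed.

Lemma op_0 a : vn_op a 0 = 0.
Proof. by have := op_scale a 0 0; rewrite !scale0r. Qed.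

Lemma op_opp a x : vn_op a (- x) = - vn_op a x.
Proof. by rewrite -scaleN1r op_scale scaleN1r. Qed.

Lemma op_sub a x y : vn_op a (x - y) = vn_op a x - vn_op a y.
Proof. by rewrite op_additive op_opp. Qed.

Lemma rip_op a x y : rip (vn_op a x) y = rip x (vn_op (star a) y).
Proof. by rewrite /rip -[in LHS](starK a) vn_op_star. Qed.

Lemma op_bounded a : exists M, forall x, hnorm (vn_op a x) <= M * hnorm x.
Proof.
have [lin cont] := vn_op_bounded a.
pose f := HB.pack (vn_op a) (GRing.isLinear.Build _ _ _ _ (vn_op a) lin)
  : {linear H -> H}.
have /linear_bounded_continuous/linear_boundedP fr : continuous f by [].
near (+oo : set_system R[i]) => r.
have r0 : 0 < r by near: r; apply: nbhs_pinfty_gt; rewrite realE lexx.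
have hr : forall x, `|f x| <= r * `|x| by near: r; exact: fr.
exists (complex.Re r) => x; have := hr x; rewrite [f x]/(vn_op a x).
rewrite !hnormE -{1}(@RRe_real _ r) ?gtr0_real // -rmorphM /= lecR //.
Unshelve. all: by end_near. Qed.

Lemma op_norm_has_sup a :
  has_sup [set complex.Re `|vn_op a x| | x in [set x : H | `|x| <= 1]].
Proof.
split; first by exists (complex.Re `|vn_op a 0|); exists 0 => //=; rewrite normr0 ler01.
have [M hM] := op_bounded a.
exists (Num.max M 0) => _ /= [x x1 <-].
apply: le_trans (hM x) _.
have {}x1 : hnorm x <= 1 by rewrite -lecR -hnormE.
apply: (@le_trans _ _ (Num.max M 0 * hnorm x)).
  by rewrite ler_wpM2r ?hnorm_ge0 // le_max lexx.
by rewrite -[leRHS]mulr1 ler_wpM2l // le_max lexx orbT.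
Qed.

(** By homogeneity from the unit ball, where the operator norm is a supremum.
    That the supremum is over a bounded set is the continuity of [vn_op a]. *)
Lemma hnorm_op a x : hnorm (vn_op a x) <= cnorm a * hnorm x.
Proof.
have [x0|x0] := eqVneq (hnorm x) 0.
  by move/hnorm_eq0: x0 => ->; rewrite op_0 hnorm0 mulr0.
have px : 0 < hnorm x by rewrite lt_neqAle hnorm_ge0 andbT eq_sym.
have := @sup_upper_bound _ _ (op_norm_has_sup a)
  (hnorm (vn_op a (((hnorm x)^-1%:C)%C *: x))).
rewrite -[sup _]/(operator_norm _) -vn_op_norm op_scale hnormZr.
rewrite gtr0_norm ?invr_gt0 // mulrC ler_pdivrMr //; apply.
exists (((hnorm x)^-1%:C)%C *: x); last first.
  by rewrite -/(hnorm _) op_scale hnormZr gtr0_norm ?invr_gt0 // mulrC.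
by rewrite /= hnormE hnormZr gtr0_norm ?invr_gt0 // mulVf.
Qed.

Lemma cnorm_le a (C : R) : 0 <= C ->
  (forall x, hnorm (vn_op a x) <= C * hnorm x) -> cnorm a <= C.
Proof.
move=> C0 hC; rewrite vn_op_norm; apply: ge_sup.
  by case: (op_norm_has_sup a).
move=> _ /= [x x1 <-]; apply: le_trans (hC x) _.
have {}x1 : hnorm x <= 1 by rewrite -lecR -hnormE.
by rewrite -[leRHS]mulr1 ler_wpM2l.
Qed.

Lemma op_inj a b : (forall x, vn_op a x = vn_op b x) -> a = b.
Proof.
move=> h; apply/eqP; rewrite -subr_eq0; apply/eqP/cnorm_eq0.
apply/eqP; rewrite eq_le cnorm_ge0 andbT; apply: cnorm_le => // x.
by rewrite opB h subrr hnorm0 mul0r.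
Qed.

(** The zero algebra being excluded, the C*-identity leaves no other value. *)
Lemma cnorm1 : cnorm (1 : A) = 1.
Proof.
have := cnorm_star_mul (1 : A); rewrite star1 mulr1 expr2 => h.
have n0 : cnorm (1 : A) != 0 by rewrite gt_eqF // cnorm_gt0 // oner_neq0.
by apply: (mulfI n0); rewrite -h mulr1.
Qed.

(** Sequential convergence in the weak operator topology, tested on real
    inner products. *)
Definition wcvg (u : nat -> A) (l : A) : Prop :=
  forall x y, rip (vn_op (u n) x) y @[n --> \oo] --> rip (vn_op l x) y.

Lemma cvg_complexP (u : nat -> R[i]^o) (l : R[i]) :
  u @ \oo --> (l : R[i]^o) <->
  (complex.Re (u n) @[n --> \oo] --> complex.Re l) /\
  (complex.Im (u n) @[n --> \oo] --> complex.Im l).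
Proof.
split.
  move=> /cvgrPdist_lt h; split; apply/cvgrPdist_lt => e e0.
    have /h : 0 < (e%:C)%C by rewrite ltcR.
    apply: filterS => n; rewrite -raddfB.
    case: (l - u n) => a b /=; rewrite normc_def ltcR /=.
    apply: le_lt_trans; rewrite -sqrtr_sqr ler_sqrt ?addr_ge0 ?sqr_ge0 //.
    by rewrite lerDl sqr_ge0.
  have /h : 0 < (e%:C)%C by rewrite ltcR.
  apply: filterS => n; rewrite -raddfB.
  case: (l - u n) => a b /=; rewrite normc_def ltcR /=.
  apply: le_lt_trans; rewrite -sqrtr_sqr ler_sqrt ?addr_ge0 ?sqr_ge0 //.
  by rewrite lerDr sqr_ge0.
move=> [/cvgrPdist_lt hr /cvgrPdist_lt hi]; apply/cvgrPdist_lt => e e0.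
have e0' : 0 < complex.Re e by have := e0; rewrite -{1}(RRe_real (gtr0_real e0)) ltcR.
have e2 : 0 < complex.Re e / 2 by lra.
near=> n.
have h1 : `|complex.Re l - complex.Re (u n)| < complex.Re e / 2 by near: n; exact: hr.
have h2 : `|complex.Im l - complex.Im (u n)| < complex.Re e / 2 by near: n; exact: hi.
rewrite -(RRe_real (gtr0_real e0)) normc_def ltcR.
move: h1 h2; rewrite -!raddfB; case: (l - u n) => a b /= h1 h2.
rewrite -(@ltr_pXn2r _ 2) ?nnegrE ?sqrtr_ge0 ?(ltW e0') // sqr_sqrtr ?addr_ge0 ?sqr_ge0 //.
rewrite -(real_normK (num_real a)) -(real_normK (num_real b)).
have := normr_ge0 a; have := normr_ge0 b; nra.
Unshelve. all: by end_near. Qed.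

Lemma wot_cvgP (u : nat -> A) (l : H -> H) :
  ((fun n => vn_op (u n) : wot H) @ \oo --> (l : wot H)) <->
  forall x y, rip (vn_op (u n) x) y @[n --> \oo] --> rip (l x) y.
Proof.
have Fu : Filter ((fun n => vn_op (u n) : wot H) @ \oo) by exact: fmap_filter.
rewrite initial_cvgP pointwise_cvgP; split => h.
  move=> x y; have /cvg_complexP[+ _] := h (x, y); exact.
move=> [x y]; apply/cvg_complexP; split; first exact: h.
have im z : complex.Im (dotp z y) = rip z ('i%C *: y) by rewrite dotp_rip.
rewrite /matrix_coefficients /= im.
by under eq_fun do rewrite im; exact: h.
Qed.

Lemma weakly_continuous_wcvg (phi : A -> A) : weakly_continuous phi ->
  forall u l, wcvg u l -> wcvg (fun n => phi (u n)) (phi l).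
Proof.
move=> cphi u l /wot_cvgP ul; apply/wot_cvgP.
have {}ul : (u : nat -> vn_wot A) @ \oo --> (l : vn_wot A).
  by apply/initial_cvgP.
have h : (fun n => phi (u n) : vn_wot A) @ \oo --> (phi l : vn_wot A).
  exact: (cvg_comp _ _ ul (cphi l)).
by move/initial_cvgP : h.
Qed.

End Operators.

From Stdlib Require Ncring Ncring_tac.

(** * Identities in noncommutative rings *)

Section NoncommutativeRing.
Variable A : nzRingType.

#[local] Instance nzring_ops :
  @Ncring.Ring_ops A 0 1 +%R *%R (fun x y => x - y) -%R eq := {}.

#[local] Instance nzring_ring : @Ncring.Ring A _ _ _ _ _ _ _ nzring_ops.
Proof.
constructor.
- exact: RelationClasses.eq_equivalence.
- by move=> ? ? -> ? ? ->.
- by move=> ? ? -> ? ? ->.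
- by move=> ? ? -> ? ? ->.
- by move=> ? ? ->.
- exact: (@add0r A).
- exact: (@addrC A).
- exact: (@addrA A).
- exact: (@mul1r A).
- exact: (@mulr1 A).
- exact: (@mulrA A).
- exact: (@mulrDl A).
- exact: (fun x y z => @mulrDr A z x y).
- by [].
- exact: (@subrr A).
Qed.

End NoncommutativeRing.
#[local] Existing Instance nzring_ops.
#[local] Existing Instance nzring_ring.

Ltac ncring := rewrite ?mulr2n ?expr2; Ncring_tac.non_commutative_ring.

(** * Weak and strong limits of sequences *)

Section WeakLimits.
Variables (R : realType) (A : vonNeumannAlgebra R).
Local Notation H := (vn_space A).
Implicit Types (a b l : A) (u : nat -> A) (x y : H).

Lemma wcvg_unique u l l' : wcvg u l -> wcvg u l' -> l = l'.
Proof.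
move=> ul ul'; apply: op_inj => x; apply/eqP; rewrite -subr_eq0; apply/eqP.
apply: hnorm_eq0; apply/eqP; rewrite -sqrf_eq0 hnorm_sq.
rewrite ripBl subr_eq0; apply/eqP.
exact: cvg_unique (ul _ _) (ul' _ _).
Qed.

Lemma wcvg_cst l : wcvg (fun=> l) l.
Proof. by move=> x y; exact: cvg_cst. Qed.

Lemma wcvgD u v l m : wcvg u l -> wcvg v m -> wcvg (fun n => u n + v n) (l + m).
Proof.
move=> ul vm x y; rewrite vn_opD ripDl.
by under eq_fun do rewrite vn_opD ripDl; apply: cvgD; [exact: ul|exact: vm].
Qed.

Lemma wcvgN u l : wcvg u l -> wcvg (fun n => - u n) (- l).
Proof.
move=> ul x y; rewrite opN ripNl.
by under eq_fun do rewrite opN ripNl; apply: cvgN; exact: ul.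
Qed.

Lemma wcvgMl b u l : wcvg u l -> wcvg (fun n => b * u n) (b * l).
Proof.
move=> ul x y; rewrite vn_opM rip_op.
by under eq_fun do rewrite vn_opM rip_op; exact: ul.
Qed.

Lemma wcvgMr b u l : wcvg u l -> wcvg (fun n => u n * b) (l * b).
Proof. by move=> ul x y; rewrite vn_opM; under eq_fun do rewrite vn_opM; exact: ul. Qed.

Lemma wcvg_star u l : wcvg u l -> wcvg (fun n => star (u n)) (star l).
Proof.
move=> ul x y; rewrite rip_op starK ripC.
by under eq_fun do rewrite rip_op starK ripC; exact: ul.
Qed.

(** Sequential convergence in the strong operator topology. *)
Definition scvg u l : Prop :=
  forall x, hnorm (vn_op (u n) x - vn_op l x) @[n --> \oo] --> (0 : R).

Lemma rip_cvg (v : nat -> H) (w y : H) :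
  hnorm (v n - w) @[n --> \oo] --> (0 : R) -> rip (v n) y @[n --> \oo] --> rip w y.
Proof.
move=> vw; apply/subr_cvg0; apply/norm_cvg0P.
have h0 : hnorm (v n - w) * hnorm y @[n --> \oo] --> (0 : R).
  by rewrite -[X in _ --> X](mul0r (hnorm y)); apply: cvgMl.
apply: (squeeze_cvgr _ (cvg_cst 0) h0); near=> n.
by rewrite normr_ge0 /= -ripBl rip_CS_abs.
Unshelve. all: by end_near. Qed.

Lemma scvg_wcvg u l : scvg u l -> wcvg u l.
Proof. by move=> ul x y; exact: rip_cvg. Qed.

Lemma ncvg_wcvg u l : cnorm (u n - l) @[n --> \oo] --> (0 : R) -> wcvg u l.
Proof.
move=> ul; apply: scvg_wcvg => x.
have h0 : cnorm (u n - l) * hnorm x @[n --> \oo] --> (0 : R).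
  by rewrite -[X in _ --> X](mul0r (hnorm x)); apply: cvgMl.
apply: (squeeze_cvgr _ (cvg_cst 0) h0); near=> n.
by rewrite hnorm_ge0 -opB hnorm_op.
Unshelve. all: by end_near. Qed.

End WeakLimits.

(** * Symmetry maps and their contractivity *)

Section Symmetries.
Variables (R : realType) (A : cstarAlgType R) (phi : A -> A).
Hypothesis sphi : symmetry_map phi.
Implicit Types a b : A.

Lemma sym0 : phi 0 = 0.
Proof.
by apply: (addrI (phi 0)); rewrite -(symmetry_add sphi) !addr0.
Qed.

Lemma symN a : phi (- a) = - phi a.
Proof.
by apply/eqP; rewrite -addr_eq0 -(symmetry_add sphi) addNr sym0.
Qed.

Lemma symB a b : phi (a - b) = phi a - phi b.
Proof. by rewrite (symmetry_add sphi) symN. Qed.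

Lemma sym_sq a : phi (a * a) = phi a * phi a.
Proof. by have [h|h] := symmetry_mul sphi; rewrite h. Qed.

Lemma symX a n : phi (a ^+ n) = phi a ^+ n.
Proof.
elim: n => [|n IH]; first by rewrite !expr0 (symmetry_one sphi).
by have [h|h] := symmetry_mul sphi; rewrite 1?exprS 1?exprSr h IH -?exprS -?exprSr.
Qed.

Lemma sym_pal a b : phi (a * b * a) = phi a * phi b * phi a.
Proof. by have [h|h] := symmetry_mul sphi; rewrite !h ?mulrA. Qed.

Lemma sym_commute a b : a * b = b * a -> phi (a * b) = phi a * phi b.
Proof. by move=> ab; have [h|h] := symmetry_mul sphi; [exact: h|rewrite ab h]. Qed.

Lemma sym_commutes a b : a * b = b * a -> phi a * phi b = phi b * phi a.
Proof. by move=> ab; rewrite -!sym_commute ?ab. Qed.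

End Symmetries.

Section Isometry.
Variables (R : realType) (A : vonNeumannAlgebra R) (phi : A -> A).
Hypotheses (sphi : symmetry_map phi) (wphi : weakly_continuous phi).
Local Notation H := (vn_space A).
Implicit Types (a b : A) (x : H).

Lemma op_exprS a n x : vn_op (a ^+ n.+1) x = vn_op a (vn_op (a ^+ n) x).
Proof. by rewrite exprS vn_opM. Qed.

Lemma cnormX a n : cnorm (a ^+ n) <= cnorm a ^+ n.
Proof.
elim: n => [|n IH]; first by rewrite !expr0 cnorm1.
rewrite !exprS; apply: le_trans (cnormM_le _ _) _.
by rewrite ler_wpM2l ?cnorm_ge0.
Qed.

Lemma starX a n : star (a ^+ n) = star a ^+ n.
Proof.
elim: n => [|n IH]; first by rewrite !expr0 star1.
by rewrite exprS starM IH -exprSr.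
Qed.

(** The sequence [hnorm (b ^+ n x)] is log-convex, so it can no longer decrease
    once it has increased; it would have to tend to [0], since
    [hnorm (b ^+ n x) ^+ 2] is the inner product of [b ^+ (2 * n) x] and [x]. *)
Lemma powers_wcvg0_contractive b : star b = b -> wcvg (fun n => b ^+ n) 0 ->
  forall x, hnorm (vn_op b x) <= hnorm x.
Proof.
move=> bs b0 x; rewrite leNgt; apply/negP => hx.
pose h n := hnorm (vn_op (b ^+ n) x).
have logconv n : h n.+1 ^+ 2 <= h n * h n.+2.
  rewrite /h hnorm_sq op_exprS rip_op bs -!op_exprS; exact: rip_CS.
have hS n : h n <= h n.+1 /\ 0 < h n.+1.
  elim: n => [|n [le1 pos]].
    rewrite /h !expr0 expr1 vn_op1; split; first exact: ltW.
    exact: le_lt_trans (hnorm_ge0 _) hx.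
  have le2 : h n.+1 <= h n.+2.
    rewrite -(ler_pM2l pos) -expr2; apply: le_trans (logconv n) _.
    by rewrite ler_wpM2r // hnorm_ge0.
  by split => //; exact: lt_le_trans pos le2.
have h1 n : h 1%N <= h n.+1.
  by elim: n => // n IH; apply: le_trans IH _; have [] := hS n.+1.
have := b0 x x; rewrite op0 rip0l => /cvgrPdist_lt/(_ (h 1%N ^+ 2)).
have [_ p1] := hS 0%N.
rewrite exprn_gt0 // => /(_ isT)[N _ /(_ (N.+1 + N.+1)%N)] /=.
rewrite (leq_trans (leqnSn N)) ?leq_addr // => /(_ isT).
rewrite exprD vn_opM rip_op starX bs -hnorm_sq sub0r normrN ger0_norm ?sqr_ge0 //.
apply/negP; rewrite -leNgt lerXn2r ?nnegrE ?hnorm_ge0 //; exact: h1.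
Qed.

(** The powers of a self-adjoint [c] with [cnorm c < 1] tend to [0] in norm;
    [phi] turns them into the powers of [phi c], and by weak continuity these
    tend weakly to [0]. *)
Lemma sym_sa_norm_le a (t : R) : star a = a -> cnorm a < t -> cnorm (phi a) <= t.
Proof.
move=> sa at1; have t0 : 0 < t by apply: le_lt_trans at1; exact: cnorm_ge0.
pose c := ((t^-1%:C)%C *: a).
have cs : star c = c by rewrite starZr sa.
have c1 : cnorm c < 1 by rewrite cnormZr gtr0_norm ?invr_gt0 // mulrC ltr_pdivrMr ?mul1r.
have cn0 : wcvg (fun n => c ^+ n) 0.
  apply: ncvg_wcvg; under eq_fun do rewrite subr0.
  have g0 : cnorm c ^+ n @[n --> \oo] --> (0 : R).
    by apply: cvg_expr; rewrite ger0_norm ?cnorm_ge0.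
  apply: (squeeze_cvgr _ (cvg_cst 0) g0); near=> n.
  by rewrite cnorm_ge0 cnormX.
have pn0 : wcvg (fun n => phi c ^+ n) 0.
  have := weakly_continuous_wcvg wphi cn0; rewrite sym0 //.
  by under eq_fun do rewrite symX //.
have ps : star (phi c) = phi c by rewrite -(symmetry_star sphi) cs.
apply: cnorm_le => [|x]; first exact: ltW.
have := powers_wcvg0_contractive ps pn0 x.
rewrite /c (symmetry_scale_real sphi) opZr hnormZr gtr0_norm ?invr_gt0 //.
by rewrite mulrC ler_pdivrMr // mulrC.
Unshelve. all: by end_near. Qed.

(** Reduced to the self-adjoint case by the C*-identity; an anti-multiplicative
    [phi] sends [a * star a] to [star (phi a) * phi a]. *)
Lemma sym_norm_le a : cnorm (phi a) <= cnorm a.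
Proof.
rewrite -(@ler_pXn2r _ 2) ?nnegrE ?cnorm_ge0 //.
apply/ler_addgt0Pr => e e0.
rewrite -cnorm_star_mul -(symmetry_star sphi).
have [h|h] := symmetry_mul sphi; rewrite -h; apply: sym_sa_norm_le.
- by rewrite starM starK.
- by rewrite cnorm_star_mul ltrDl.
- by rewrite starM starK.
- by rewrite cnorm_mul_star ltrDl.
Qed.

End Isometry.

(** * Positive elements *)

Section Positivity.
Variables (R : realType) (A : vonNeumannAlgebra R).
Local Notation H := (vn_space A).
Implicit Types (a b : A) (x y : H).

Definition selfadjoint a : Prop := star a = a.

Definition positive a : Prop := forall x, 0 <= rip (vn_op a x) x.

Lemma positive_sq a : selfadjoint a -> positive (a * a).
Proof. by move=> sa x; rewrite vn_opM rip_op sa rip_ge0. Qed.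

Lemma positiveD a b : positive a -> positive b -> positive (a + b).
Proof. by move=> pa pb x; rewrite vn_opD ripDl addr_ge0. Qed.

Lemma positiveZ (r : R) a : 0 <= r -> positive a -> positive ((r%:C)%C *: a).
Proof. by move=> r0 pa x; rewrite opZr ripZl mulr_ge0. Qed.

Lemma positive1 : positive 1.
Proof. by move=> x; rewrite vn_op1 rip_ge0. Qed.

Lemma positive_conj a b : selfadjoint b -> positive a -> positive (b * a * b).
Proof. by move=> sb pa x; rewrite !vn_opM rip_op sb. Qed.

Lemma positive_wcvg (u : nat -> A) a :
  wcvg u a -> (forall n, positive (u n)) -> positive a.
Proof.
move=> ua pu x; apply: (cvgr_to_ge (ua x x)).
by near=> n; exact: pu.
Unshelve. all: by end_near. Qed.

Lemma positive_norm a (t : R) : selfadjoint a -> cnorm a <= t ->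
  positive ((t%:C)%C *: 1 - a).
Proof.
move=> sa at_ x; rewrite opB opZr vn_op1 ripBl ripZl -hnorm_sq subr_ge0.
apply: le_trans (rip_CS _ _) _; rewrite expr2 mulrA ler_wpM2r ?hnorm_ge0 //.
apply: le_trans (hnorm_op _ _) _; by rewrite ler_wpM2r ?hnorm_ge0.
Qed.

Lemma selfadjointD a b : selfadjoint a -> selfadjoint b -> selfadjoint (a + b).
Proof. by rewrite /selfadjoint starD => -> ->. Qed.
Lemma selfadjointN a : selfadjoint a -> selfadjoint (- a).
Proof. by rewrite /selfadjoint starN => ->. Qed.
Lemma selfadjointB a b : selfadjoint a -> selfadjoint b -> selfadjoint (a - b).
Proof. by rewrite /selfadjoint starB => -> ->. Qed.
Lemma selfadjointM a b : selfadjoint a -> selfadjoint b -> a * b = b * a ->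
  selfadjoint (a * b).
Proof. by rewrite /selfadjoint starM => -> ->. Qed.
Lemma selfadjoint1 : selfadjoint 1.
Proof. exact: star1. Qed.
Lemma selfadjointZ (r : R) a : selfadjoint a -> selfadjoint ((r%:C)%C *: a).
Proof. by rewrite /selfadjoint starZr => ->. Qed.
Lemma selfadjoint_conj a b : selfadjoint a -> selfadjoint b ->
  selfadjoint (b * a * b).
Proof. by rewrite /selfadjoint !starM mulrA => -> ->. Qed.

(** Unfolding [g k = g k * g k + g k.+1] writes [a] as a sum of squares plus a
    remainder.  Taking [b := 1] bounds these squares, which forces the remainder
    to be small along [x]. *)
Lemma riesz_sum (g : nat -> A) a x n : g 0%N = a ->
  (forall k, g k.+1 = g k - g k * g k) ->
  (forall k, selfadjoint (g k)) ->
  forall b, selfadjoint b -> (forall k, g k * b = b * g k) ->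
  rip (vn_op (a * b) x) x =
  \sum_(k < n) rip (vn_op b (vn_op (g k) x)) (vn_op (g k) x) +
  rip (vn_op (g n * b) x) x.
Proof.
move=> g0 gS gs b bs gb; elim: n => [|n ->]; first by rewrite big_ord0 add0r g0.
rewrite big_ord_recr /= -addrA; congr (_ + _).
have -> : g n * b = g n * b * g n + g n.+1 * b.
  by rewrite gS mulrBl -!mulrA gb addrC subrK.
by rewrite vn_opD ripDl -mulrA (vn_opM (g n)) (vn_opM b) (rip_op (g n)) gs.
Qed.

(** Riesz's argument.  The [g k] stay between [0] and [1], the squares
    [hnorm (g k x) ^+ 2] have bounded sums, so [hnorm (g k x)] takes arbitrarily
    small values.  The first part of [riesz_sum] is nonnegative, hence the form of
    [a * b] at [x] is at least that of [g k * b], which is then as close to [0]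
    as desired. *)
Lemma positiveM_le1 a b : selfadjoint a -> selfadjoint b -> a * b = b * a ->
  positive a -> positive (1 - a) -> positive b -> positive (a * b).
Proof.
move=> sa sb ab pa pa1 pb.
pose g := fix g n := if n is n'.+1 then g n' - g n' * g n' else a.
have gS k : g k.+1 = g k - g k * g k by [].
have gs k : selfadjoint (g k).
  by elim: k => // k IH; apply: selfadjointB => //; exact: selfadjointM.
have gb k : g k * b = b * g k.
  by elim: k => // k IH; rewrite gS mulrBl mulrBr -mulrA IH mulrA IH mulrA.
have gp k : positive (g k) /\ positive (1 - g k).
  elim: k => // k [p1 p2]; split.
    have -> : g k.+1 = (1 - g k) * g k * (1 - g k) + g k * (1 - g k) * g k.
      by rewrite gS; ncring.
    apply: positiveD; apply: positive_conj => //.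
    by apply: selfadjointB => //; exact: selfadjoint1.
  have -> : 1 - g k.+1 = (1 - g k) + g k * g k by rewrite gS; ncring.
  by apply: positiveD => //; exact: positive_sq.
move=> x; rewrite leNgt; apply/negP => lt0.
have sum_b n : rip (vn_op (g n * b) x) x <= rip (vn_op (a * b) x) x.
  by rewrite (riesz_sum x n (erefl a : g 0%N = a) gS gs sb gb) lerDr sumr_ge0.
have sum_1 n : \sum_(k < n) hnorm (vn_op (g k) x) ^+ 2 <= rip (vn_op a x) x.
  have := riesz_sum x n (erefl (g 0%N)) gS gs selfadjoint1.
  rewrite -[a]mulr1 => ->; last by move=> k; rewrite mulr1 mul1r.
  under eq_bigr do rewrite hnorm_sq -[X in rip X _]vn_op1.
  by rewrite lerDl mulr1; have [] := gp n.
pose bx := hnorm (vn_op b x).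
have lower n : - rip (vn_op (a * b) x) x <= hnorm (vn_op (g n) x) * bx.
  rewrite lerNl; apply: le_trans (sum_b n).
  rewrite vn_opM rip_op gs ripC lerNl -ripNl -(hnorm_opp (vn_op (g n) x)).
  exact: rip_CS.
have bx0 : 0 < bx.
  rewrite lt_neqAle hnorm_ge0 andbT eq_sym; apply/eqP => h.
  by have := lower 0%N; rewrite h mulr0 lerNl oppr0 leNgt lt0.
pose d := - rip (vn_op (a * b) x) x / bx.
have d0 : 0 < d by rewrite divr_gt0 // oppr_gt0.
have dn n : d <= hnorm (vn_op (g n) x) by rewrite ler_pdivrMr.
have bound n : n%:R * d ^+ 2 <= rip (vn_op a x) x.
  apply: le_trans (sum_1 n); rewrite mulr_natl -[n in _ *+ n]card_ord -sumr_const.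
  by apply: ler_sum => k _; rewrite lerXn2r ?nnegrE ?hnorm_ge0 // ltW.
have [n hn] : exists n : nat, rip (vn_op a x) x / d ^+ 2 < n%:R.
  exists (Num.bound (rip (vn_op a x) x / d ^+ 2)).
  by apply: le_lt_trans (archi_boundP _); rewrite ?ler_norm // divr_ge0 ?pa ?sqr_ge0.
by have := bound n; rewrite leNgt -ltr_pdivrMr ?exprn_gt0 // hn.
Qed.

(** After scaling to [a <= 1].  The squares of Riesz's argument stand in for the
    square root of [a], by which one would otherwise conjugate [b]. *)
Lemma positiveM a b : selfadjoint a -> selfadjoint b -> a * b = b * a ->
  positive a -> positive b -> positive (a * b).
Proof.
move=> sa sb ab pa pb.
pose t := cnorm a + 1.
have t0 : 0 < t by rewrite ltr_wpDl ?cnorm_ge0.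
pose c := ((t^-1%:C)%C *: a).
have ac : a = (t%:C)%C *: c.
  by rewrite /c scalerA -rmorphM mulfV ?gt_eqF // scale1r.
rewrite ac -scalerAl; apply: positiveZ; first exact: ltW.
have ti : 0 <= t^-1 by rewrite invr_ge0 ltW.
apply: positiveM_le1 => //.
- exact: selfadjointZ.
- by rewrite /c -scalerAl -scalerAr ab.
- exact: positiveZ.
have := @positive_norm c 1 (selfadjointZ _ sa); rewrite scale1r; apply.
by rewrite /c cnormZr ger0_norm // mulrC ler_pdivrMr // mul1r lerDl.
Qed.

(** The polarization identity and the parallelogram law, at the vector [y] of
    norm [hnorm x] in the direction of [a x]. *)
Lemma numerical_radius a (t : R) : selfadjoint a -> 0 <= t ->
  (forall x, rip (vn_op a x) x <= t * hnorm x ^+ 2) ->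
  (forall x, - (t * hnorm x ^+ 2) <= rip (vn_op a x) x) ->
  cnorm a <= t.
Proof.
move=> sa t0 hu hl; apply: cnorm_le => // x.
have [/eqP ax0|ax0] := boolP (hnorm (vn_op a x) == 0).
  by rewrite ax0 mulr_ge0 ?hnorm_ge0.
have [/eqP x0|x0] := boolP (hnorm x == 0).
  by move: ax0; rewrite (hnorm_eq0 x0) op_0 hnorm0 eqxx.
have pax : 0 < hnorm (vn_op a x) by rewrite lt_neqAle eq_sym ax0 hnorm_ge0.
have px : 0 < hnorm x by rewrite lt_neqAle eq_sym x0 hnorm_ge0.
pose r := hnorm x / hnorm (vn_op a x).
pose y := (r%:C)%C *: vn_op a x.
have ny : hnorm y = hnorm x.
  by rewrite hnormZr ger0_norm ?divr_ge0 ?hnorm_ge0 // divfK.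
have pol : 4 * rip (vn_op a x) y =
    rip (vn_op a (x + y)) (x + y) - rip (vn_op a (x - y)) (x - y).
  rewrite op_sub op_additive !(ripDl, ripDr, ripNl, ripNr).
  rewrite (rip_op a y x) sa (ripC y (vn_op a x)); ring.
have : 4 * rip (vn_op a x) y <= t * (2 * hnorm x ^+ 2 + 2 * hnorm y ^+ 2).
  rewrite pol; have := hu (x + y); have := hl (x - y).
  rewrite hnorm_sqB hnorm_sqD => h1 h2; lra.
rewrite ny ripZr -hnorm_sq /r => h.
have e : hnorm x / hnorm (vn_op a x) * hnorm (vn_op a x) ^+ 2 = hnorm x * hnorm (vn_op a x).
  by rewrite expr2 mulrA divfK.
rewrite e in h; rewrite -(ler_pM2l px); nra.
Qed.

End Positivity.

(** * Existence of strong limits *)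

Section StrongLimits.
Variables (R : realType) (A : vonNeumannAlgebra R).
Local Notation H := (vn_space A).
Implicit Types (a b : A) (x y : H) (u v : nat -> A).

Lemma hnorm_lim (w : nat -> H) (l : H) : w @ \oo --> l <->
  hnorm (w n - l) @[n --> \oo] --> (0 : R).
Proof.
split=> [/cvgrPdist_lt h|/cvgrPdist_lt h].
  apply/cvgrPdist_lt => e e0.
  have /h : 0 < (e%:C)%C by rewrite ltcR.
  apply: filterS => n; rewrite hnormE ltcR sub0r normrN ger0_norm ?hnorm_ge0 //.
  by rewrite -opprB hnorm_opp.
apply/cvgrPdist_lt => e e0.
have er : e = ((complex.Re e)%:C)%C by rewrite RRe_real // gtr0_real.
have /h : 0 < complex.Re e by rewrite -ltcR -er.
apply: filterS => n; rewrite sub0r normrN ger0_norm ?hnorm_ge0 // er hnormE ltcR.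
by rewrite -[in X in _ -> X]opprB hnorm_opp.
Qed.

(** A Cauchy criterion with a real tolerance, the scalars being complex. *)
Lemma hilbert_complete (w : nat -> H) :
  (forall e : R, 0 < e -> exists N : nat, forall m n : nat, (N <= n)%N -> (n <= m)%N ->
     hnorm (w m - w n) < e) ->
  exists l, hnorm (w n - l) @[n --> \oo] --> (0 : R).
Proof.
move=> cw.
have /cauchy_cvg wc : cauchy (w @ \oo).
  apply/cauchy_ballP => e e0.
  have er : e = ((complex.Re e)%:C)%C by rewrite RRe_real // gtr0_real.
  have e0' : 0 < complex.Re e by rewrite -ltcR -er.
  have [N hN] := cw _ e0'.
  have hN' m n : (N <= m)%N -> (N <= n)%N -> ball (w m) e (w n).
    move=> Nm Nn; rewrite -ball_normE /= er hnormE ltcR.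
    have [nm|mn] := leqP n m; first exact: hN.
    by rewrite -opprB hnorm_opp; apply: hN => //; exact: ltnW.
  exists ([set w n | n in [set n | (N <= n)%N]], [set w n | n in [set n | (N <= n)%N]]).
    by split; exists N => // n Nn; exists n.
  by move=> [_ _] [/= [m Nm <-] [n Nn <-]]; exact: hN'.
by exists (lim (w @ \oo)); apply/hnorm_lim.
Qed.

(** The pointwise limit is a bounded operator in the weak closure of the
    algebra, so it belongs to the algebra. *)
Lemma strong_limit u :
  (forall n x, hnorm (vn_op (u n) x) <= hnorm x) ->
  (forall x (e : R), 0 < e -> exists N : nat, forall m n : nat, (N <= n)%N -> (n <= m)%N ->
     hnorm (vn_op (u m) x - vn_op (u n) x) < e) ->
  exists l, scvg u l.
Proof.
move=> ub uc.
have /choice[T hT] : forall x, exists l, hnorm (vn_op (u n) x - l) @[n --> \oo] --> (0 : R).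
  by move=> x; apply: hilbert_complete; exact: uc.
have hT' x : (fun n => vn_op (u n) x) @ \oo --> T x by apply/hnorm_lim; exact: hT.
have Tlin : linear T.
  move=> c x y.
  have h : (fun n => vn_op (u n) (c *: x + y)) @ \oo --> c *: T x + T y.
    have -> : (fun n => vn_op (u n) (c *: x + y)) =
              (fun n => c *: vn_op (u n) x + vn_op (u n) y).
      by apply/funext => n; rewrite op_additive op_scale.
    by apply: cvgD; [apply: cvgZr; exact: hT'|exact: hT'].
  exact: cvg_unique (hT' (c *: x + y)) h.
have Tb x : hnorm (T x) <= hnorm x.
  apply/ler_addgt0Pr => e e0.
  have /cvgrPdist_lt/(_ e e0)[N _ /(_ N (leqnn N))] := hT x.
  rewrite /= sub0r normrN ger0_norm ?hnorm_ge0 // => h.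
  have -> : T x = vn_op (u N) x - (vn_op (u N) x - T x) by rewrite opprB addrC subrK.
  apply: le_trans (hnorm_triangle _ _) _; rewrite hnorm_opp.
  by apply: lerD; [exact: ub|exact: ltW].
have Tcont : continuous T.
  pose f := HB.pack T (GRing.isLinear.Build _ _ _ _ T Tlin) : {linear H -> H}.
  have : continuous f; last by [].
  apply/linear_bounded_continuous/bounded_funP => r; exists r => x xr.
  by apply: le_trans xr; rewrite !hnormE lecR; exact: Tb.
have [|l _ lT] := @vn_wot_closed R A T (conj Tlin Tcont).
  move=> B nB.
  have : (fun n => vn_op (u n) : wot H) @ \oo --> (T : wot H).
    by apply/wot_cvgP => x y; apply: rip_cvg; exact: hT.
  move=> /(_ B nB)[N _ /(_ N (leqnn N)) BN].
  by exists (vn_op (u N)); split => //; exists (u N).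
by exists l => x; rewrite lT; exact: hT.
Qed.

Lemma scvgM u v a b : (forall n x, hnorm (vn_op (u n) x) <= hnorm x) ->
  scvg u a -> scvg v b -> scvg (fun n => u n * v n) (a * b).
Proof.
move=> ub ua vb x.
have h : hnorm (vn_op (v n) x - vn_op b x) +
  hnorm (vn_op (u n) (vn_op b x) - vn_op a (vn_op b x)) @[n --> \oo] --> (0 : R).
  by rewrite -[X in _ --> X](addr0 0); apply: cvgD; [exact: vb|exact: ua].
apply: (squeeze_cvgr _ (cvg_cst 0) h); near=> n.
rewrite hnorm_ge0 /= !vn_opM.
rewrite -(subrK (vn_op (u n) (vn_op b x)) (vn_op (u n) (vn_op (v n) x))) -addrA.
apply: le_trans (hnorm_triangle _ _) _; rewrite lerD2r -op_sub; exact: ub.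
Unshelve. all: by end_near. Qed.

End StrongLimits.

(** * The sign of a self-adjoint contraction *)

Section Sign.
Variables (R : realType) (A : vonNeumannAlgebra R).
Local Notation H := (vn_space A).
Implicit Types (a b T : A) (x y : H).

Definition halve a : A := ((2^-1)%:C)%C *: a.

Lemma halveD a : halve a + halve a = a.
Proof.
rewrite /halve -scalerDl -rmorphD (_ : 2^-1 + 2^-1 = 1 :> R) ?rmorph1 ?scale1r //.
by field.
Qed.

(** The Newton-Schulz iteration for the sign function.  It is polynomial with
    real coefficients and odd, so symmetry maps commute with it; on [[-1, 1]] it
    moves every nonzero real monotonically to [1] or [-1]. *)
Fixpoint newton_schulz T n : A :=
  if n is n'.+1 then
    let f := newton_schulz T n' in halve (f * (1 + 1 + 1 - f * f))
  else T.

Local Notation ns := newton_schulz.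

Lemma nsS T n : ns T n.+1 + ns T n.+1 = ns T n * (1 + 1 + 1 - ns T n * ns T n).
Proof. exact: halveD. Qed.

Lemma halve_inj a b : a + a = b + b -> a = b.
Proof. by move=> h; rewrite -(halveD a) -(halveD b) /halve -!scalerDr h. Qed.

Lemma ns_intertwine T T' b n : b * T = T' * b -> b * ns T n = ns T' n * b.
Proof.
move=> h; elim: n => //= n IH; rewrite /halve -scalerAr -scalerAl; congr (_ *: _).
have e2 : b * (ns T n * ns T n) = ns T' n * ns T' n * b.
  by rewrite mulrA IH -mulrA IH mulrA.
rewrite mulrA IH -!mulrA; congr (_ * _).
by rewrite mulrBr mulrBl e2 !mulrDr !mulrDl !mulr1 !mul1r.
Qed.

Lemma ns_opp T n : ns (- T) n = - ns T n.
Proof.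
elim: n => //= n ->; rewrite /halve -scalerN; congr (_ *: _).
by rewrite mulrNN mulNr.
Qed.

Lemma ns_sym (phi : A -> A) T n : symmetry_map phi -> phi (ns T n) = ns (phi T) n.
Proof.
move=> sphi; elim: n => //= n <-; rewrite /halve (symmetry_scale_real sphi).
congr (_ *: _); rewrite sym_commute //.
  by rewrite symB // sym_sq // !(symmetry_add sphi) (symmetry_one sphi).
by ncring.
Qed.

Section Convergence.
Variable T : A.
Hypotheses (saT : selfadjoint T) (T1 : cnorm T <= 1).
Local Notation f := (ns T).

Lemma ns_sa n : selfadjoint (f n).
Proof.
elim: n => //= n IH; apply: selfadjointZ; apply: selfadjointM => //.
  apply: selfadjointB; last exact: selfadjointM.
  by do 2?apply: selfadjointD; exact: selfadjoint1.
by ncring.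
Qed.

Lemma ns_comm n m : f n * f m = f m * f n.
Proof. by apply: ns_intertwine; apply/esym; apply: ns_intertwine. Qed.

Lemma positive_quarter a : positive (a + a + a + a) -> positive a.
Proof. by move=> pa x; have := pa x; rewrite !vn_opD !ripDl; lra. Qed.

(** With [g := 1 - f n * f n] the next gap is [(3 * g ^+ 2 + g ^+ 3) / 4]. *)
Lemma ns_gap n : positive (1 - f n * f n).
Proof.
elim: n => [|n IH] /=.
  move=> x; rewrite opB vn_op1 vn_opM ripBl rip_op saT -!hnorm_sq subr_ge0.
  rewrite lerXn2r ?nnegrE ?hnorm_ge0 //; apply: le_trans (hnorm_op _ _) _.
  by rewrite ler_piMl ?hnorm_ge0.
apply: positive_quarter.
set g := 1 - f n * f n in IH *.
have sg : selfadjoint g.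
  by apply: selfadjointB; [exact: selfadjoint1|apply: selfadjointM => //; exact: ns_sa].
set f' := halve _; have hf' : f' + f' = f n * (1 + 1 + 1 - f n * f n) by exact: halveD.
have -> : 1 - f' * f' + (1 - f' * f') + (1 - f' * f') + (1 - f' * f') =
          g * g + g * g + g * g + g * g * g.
  transitivity (1 + 1 + 1 + 1 - (f' + f') * (f' + f')); first by ncring.
  by rewrite hf' /g; ncring.
by do 3?apply: positiveD; [exact: positive_sq..|exact: positive_conj].
Qed.

Lemma ns_contr n x : hnorm (vn_op (f n) x) <= hnorm x.
Proof.
have := ns_gap n x; rewrite opB vn_op1 vn_opM ripBl rip_op ns_sa -!hnorm_sq subr_ge0.
by rewrite ler_pXn2r ?nnegrE ?hnorm_ge0.
Qed.

(** Each step multiplies the iterate by [1 + g / 2], where [g] is a gap as in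
    [ns_gap]; a product of commuting elements above [1] is above [1]. *)
Lemma ns_ratio n m : exists h, [/\ f (n + m)%N = f n * h, selfadjoint h,
  positive (h - 1) & forall b, b * T = T * b -> b * h = h * b].
Proof.
elim: m => [|m [h [fh sh ph ch]]].
  exists 1; split; rewrite ?addn0 ?mulr1 //; first exact: selfadjoint1.
    by move=> x; rewrite subrr op0 rip0l.
  by move=> b _; rewrite mulr1 mul1r.
have fT k : f k * T = T * f k by apply/esym; exact: (@ns_intertwine T T T).
set g := 1 - f (n + m)%N * f (n + m)%N.
have sg : selfadjoint g.
  by apply: selfadjointB; [exact: selfadjoint1|apply: selfadjointM => //; exact: ns_sa].
have cg b : b * T = T * b -> b * g = g * b.
  move=> bT; have e : b * f (n + m)%N = f (n + m)%N * b by exact: ns_intertwine.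
  by rewrite /g mulrBr mulrBl mulr1 mul1r mulrA e -mulrA e mulrA.
have hg : h * g = g * h.
  by apply/esym/ch; apply/esym; apply: cg.
have pg : positive g by exact: ns_gap.
exists (h * (1 + halve g)); split.
- apply: halve_inj; rewrite addnS nsS mulrA -fh.
  rewrite -mulrDr; congr (_ * _).
  transitivity (1 + 1 + (halve g + halve g)); last by ncring.
  by rewrite halveD /g; ncring.
- apply: selfadjointM => //.
    by apply: selfadjointD; [exact: selfadjoint1|exact: selfadjointZ].
  by rewrite mulrDr mulrDl mulr1 mul1r /halve -scalerAr -scalerAl hg.
- have -> : h * (1 + halve g) - 1 = (h - 1) + halve (h * g).
    by rewrite mulrDr mulr1 /halve -scalerAr addrAC.
  apply: positiveD => //; apply: positiveZ; first by rewrite invr_ge0 ler0n.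
  apply: positiveM => //; rewrite -(subrK 1 h).
  by apply: positiveD => //; exact: positive1.
- move=> b bT; rewrite mulrA ch // -mulrA -mulrA; congr (_ * _).
  by rewrite mulrDr mulrDl mulr1 mul1r /halve -scalerAr -scalerAl cg.
Qed.

(** Amounts to [f n * f m >= f n * f n], which holds as [f m = f n * h] with
    [h >= 1].  It reduces the convergence of the vectors [f n x] to that of the
    bounded monotone sequence of their norms. *)
Lemma ns_increment n m x : (n <= m)%N ->
  hnorm (vn_op (f m) x - vn_op (f n) x) ^+ 2 <=
  hnorm (vn_op (f m) x) ^+ 2 - hnorm (vn_op (f n) x) ^+ 2.
Proof.
move=> /subnKC <-; have [h [fh sh ph _]] := ns_ratio n (m - n).
have : 0 <= rip (vn_op (f n * (h - 1) * f n) x) x.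
  by apply: positive_conj => //; exact: ns_sa.
have adj y : rip (vn_op (f n) y) x = rip y (vn_op (f n) x) by rewrite rip_op ns_sa.
rewrite mulrBr mulr1 -fh mulrBl ns_comm opB !vn_opM ripBl !adj -hnorm_sq.
rewrite hnorm_sqB; lra.
Qed.

Lemma ns_limit : exists l, scvg f l.
Proof.
apply: strong_limit; first exact: ns_contr.
move=> x e e0.
pose a n := hnorm (vn_op (f n) x) ^+ 2.
have ub : has_ubound (range a).
  exists (hnorm x ^+ 2) => _ [n _ <-].
  by rewrite lerXn2r ?nnegrE ?hnorm_ge0 // ns_contr.
have hs : has_sup (range a) by split => //; exists (a 0%N); exists 0%N.
have [_ [N _ <-] hN] := sup_adherent (exprn_gt0 2 e0) hs.
exists N => m n Nn nm; rewrite -(@ltr_pXn2r _ 2) ?nnegrE ?hnorm_ge0 ?(ltW e0) //.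
apply: le_lt_trans (ns_increment x nm) _.
have : a m <= sup (range a) by apply: sup_upper_bound => //; exists m.
have : a N <= a n.
  have := ns_increment x Nn.
  by have := sqr_ge0 (hnorm (vn_op (f n) x - vn_op (f N) x)); rewrite /a; lra.
by move: hN; rewrite /a; lra.
Qed.

End Convergence.

Definition sgn T : A := xget 0 [set l | scvg (ns T) l].

Lemma sgn_scvg T : selfadjoint T -> cnorm T <= 1 -> scvg (ns T) (sgn T).
Proof.
move=> saT T1; have [l hl] := ns_limit saT T1.
exact: (@xgetPex _ 0 [set l | scvg (ns T) l]) (ex_intro _ l hl).
Qed.

Section SignTheory.
Variable T : A.
Hypotheses (saT : selfadjoint T) (T1 : cnorm T <= 1).
Local Notation s := (sgn T).

Lemma sgn_wcvg : wcvg (ns T) s.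
Proof. exact: scvg_wcvg (sgn_scvg saT T1). Qed.

Lemma sgn_sa : selfadjoint s.
Proof.
apply: (@wcvg_unique _ _ (ns T)); last exact: sgn_wcvg.
have := wcvg_star sgn_wcvg; congr wcvg; apply/funext => n; exact: ns_sa.
Qed.

(** Every iterate intertwines in the same way. *)
Lemma sgn_intertwine T' b : selfadjoint T' -> cnorm T' <= 1 ->
  b * T = T' * b -> b * s = sgn T' * b.
Proof.
move=> saT' T1' h; apply: (@wcvg_unique _ _ (fun n => b * ns T n)).
  exact: wcvgMl sgn_wcvg.
have -> : (fun n => b * ns T n) = (fun n => ns T' n * b).
  by apply/funext => n; exact: ns_intertwine.
exact/wcvgMr/scvg_wcvg/sgn_scvg.
Qed.

Lemma sgn_comm b : b * T = T * b -> b * s = s * b.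
Proof. exact: sgn_intertwine. Qed.

Lemma sgn_self : T * s = s * T.
Proof. exact: sgn_comm. Qed.

(** The limit is a fixed point of the iteration: [2 * s = s * (3 - s * s)]. *)
Lemma sgn_cube : s * s * s = s.
Proof.
have lim3 : wcvg (fun n => ns T n * ns T n * ns T n) (s * s * s).
  apply: scvg_wcvg; apply: scvgM; last exact: (sgn_scvg saT T1).
    move=> n x; rewrite vn_opM; apply: le_trans (ns_contr saT T1 _ _) _; exact: ns_contr.
  by apply: scvgM; [exact: ns_contr|exact: (sgn_scvg saT T1)|exact: (sgn_scvg saT T1)].
have limS : wcvg (fun n => ns T n.+1) s.
  move=> x y; have := @sgn_wcvg x y.
  by rewrite -(cvg_shiftS (fun n => rip (vn_op (ns T n) x) y)).
have e : s + s = s + s + s - s * s * s.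
  apply: (@wcvg_unique _ _ (fun n => ns T n.+1 + ns T n.+1)); first exact: wcvgD.
  have -> : (fun n => ns T n.+1 + ns T n.+1) =
            (fun n => ns T n + ns T n + ns T n + - (ns T n * ns T n * ns T n)).
    by apply/funext => n; rewrite nsS; ncring.
  apply: wcvgD; last exact: wcvgN.
  by do 2?apply: wcvgD; exact: sgn_wcvg.
have : s + s + (s * s * s) = s + s + s by rewrite {1}e subrK.
by move/addrI.
Qed.

(** [s * T] is the absolute value of [T], and [|T| >= T ^+ 2] for a contraction. *)
Lemma sgn_abs_ge : positive (s * T - T * T).
Proof.
apply: (@positive_wcvg _ _ (fun n => ns T n * T - T * T)).
  by apply: wcvgD; [apply: wcvgMr; exact: sgn_wcvg|exact: wcvg_cst].
move=> n; have [h [fh sh ph ch]] := ns_ratio saT T1 0 n.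
rewrite add0n /= in fh; rewrite fh.
have -> : T * h * T - T * T = T * (h - 1) * T by ncring.
exact: positive_conj.
Qed.

Lemma sgn_abs : positive (s * T).
Proof.
rewrite -(subrK (T * T) (s * T)); apply: positiveD; first exact: sgn_abs_ge.
exact: positive_sq.
Qed.

(** [K] projects onto the kernel of [s].  There [s * T] vanishes, hence so does
    the smaller [T * T], and then [T]. *)
Lemma sgn_supp : T * (s * s) = T.
Proof.
pose K := 1 - s * s.
have sK : s * K = 0 by rewrite mulrBr mulr1 mulrA sgn_cube subrr.
suff : T * K = 0 by rewrite /K mulrBr mulr1 => /eqP; rewrite subr_eq0 => /eqP/esym.
apply: op_inj => x; rewrite op0; apply: hnorm_eq0.
apply/eqP; rewrite -sqrf_eq0 eq_le sqr_ge0 andbT.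
have := sgn_abs_ge (vn_op K x).
rewrite opB ripBl subr_ge0 -sgn_self (vn_opM T s) -(vn_opM s K) sK op0 op_0 rip0l.
by rewrite (vn_opM T T) (rip_op T) saT -hnorm_sq -vn_opM.
Qed.

Lemma sgn_sym (phi : A -> A) : symmetry_map phi -> weakly_continuous phi ->
  phi s = sgn (phi T).
Proof.
move=> sphi wphi; apply: (@wcvg_unique _ _ (ns (phi T))).
  have := weakly_continuous_wcvg wphi sgn_wcvg; congr wcvg.
  by apply/funext => n; exact: ns_sym.
apply/scvg_wcvg/sgn_scvg.
  by rewrite /selfadjoint -[in RHS]saT (symmetry_star sphi).
by apply: le_trans T1; exact: sym_norm_le.
Qed.

Lemma sgn_opp : sgn (- T) = - s.
Proof.
apply: (@wcvg_unique _ _ (ns (- T))).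
  apply/scvg_wcvg/sgn_scvg; last by rewrite cnormN.
  exact: selfadjointN.
have := wcvgN sgn_wcvg; congr wcvg; apply/funext => n; exact/esym/ns_opp.
Qed.

End SignTheory.
End Sign.

(** * Spectral projections of half-lines *)

Section SpectralProjection.
Variables (R : realType) (A : vonNeumannAlgebra R).
Local Notation H := (vn_space A).
Implicit Types (a b c X T P Q E F : A) (x y : H) (r t k : R).

Definition scal r : A := (r%:C)%C *: 1.

Lemma scalE r a : scal r * a = (r%:C)%C *: a.
Proof. by rewrite /scal -scalerAl mul1r. Qed.

Lemma scalC r a : scal r * a = a * scal r.
Proof. by rewrite scalE /scal -scalerAr mulr1. Qed.

Lemma op_scal r x : vn_op (scal r) x = (r%:C)%C *: x.
Proof. by rewrite opZr vn_op1. Qed.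

Lemma scal_sa r : selfadjoint (scal r).
Proof. exact/selfadjointZ/selfadjoint1. Qed.

Lemma cnorm_scal r : cnorm (scal r) = `|r|.
Proof. by rewrite cnormZr cnorm1 mulr1. Qed.

Definition is_proj P : Prop := selfadjoint P /\ P * P = P.

Lemma proj_norm P : is_proj P -> cnorm P <= 1.
Proof.
move=> [sP PP]; have := cnorm_star_mul P; rewrite sP PP => h.
have := cnorm_ge0 P; nra.
Qed.

Lemma projC P : is_proj P -> is_proj (1 - P).
Proof.
move=> [sP PP]; split; first by apply: selfadjointB => //; exact: selfadjoint1.
by rewrite mulrBr mulr1 mulrBl mul1r PP subrr subr0.
Qed.

Lemma hnorm_proj P x : is_proj P -> hnorm (vn_op P x) <= hnorm x.
Proof.
move=> /proj_norm P1; apply: le_trans (hnorm_op _ _) _.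
by rewrite ler_piMl ?hnorm_ge0.
Qed.

(** The quadratic form of [C] is at least [k] on the range of [P]. *)
Definition form_ge k C P : Prop :=
  forall x, k * hnorm (vn_op P x) ^+ 2 <= rip (vn_op C (vn_op P x)) (vn_op P x).

(** Cauchy-Schwarz: an operator whose form is at least [k] on a subspace
    expands the vectors of that subspace by at least [k]. *)
Lemma form_ge_norm k C P c : form_ge k C P -> P * c = c ->
  k * cnorm c <= cnorm (C * c).
Proof.
move=> hC Pc; have [k0|k0] := leP k 0.
  by apply: le_trans (cnorm_ge0 _); rewrite mulr_le0_ge0 ?cnorm_ge0.
rewrite mulrC -ler_pdivlMr //; apply: cnorm_le => [|x].
  by rewrite divr_ge0 ?cnorm_ge0 ?ltW.
rewrite mulrAC ler_pdivlMr // mulrC.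
have := hC (vn_op c x); rewrite -(vn_opM P) Pc -vn_opM => h.
have := le_trans h (rip_CS _ _).
have [->|y0] := eqVneq (hnorm (vn_op c x)) 0.
  by move=> _; rewrite mulr0 mulr_ge0 ?cnorm_ge0 ?hnorm_ge0.
have py : 0 < hnorm (vn_op c x) by rewrite lt_neqAle eq_sym y0 hnorm_ge0.
by rewrite expr2 mulrA ler_pM2r // => /le_trans; apply; exact: hnorm_op.
Qed.

Lemma form_geD k k' C C' P : form_ge k C P -> form_ge k' C' P ->
  form_ge (k + k') (C + C') P.
Proof.
by move=> h h' x; rewrite vn_opD ripDl mulrDl lerD.
Qed.

Lemma form_ge_scal r P : form_ge r (scal r) P.
Proof. by move=> x; rewrite op_scal ripZl hnorm_sq. Qed.

(** The spectral projection of [X] for the half-line above [t]: the function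
    [(s + s ^+ 2) / 2] is the indicator of [s = 1] among [-1, 0, 1].  The factor
    [1/4] makes [X - t] a contraction when [cnorm X <= 3] and [|t| <= 1]. *)
Definition spp t X : A :=
  let s := sgn ((4^-1%:C)%C *: (X - scal t)) in halve (s + s * s).

Section Theory.
Variables (t : R) (X : A).
Hypotheses (saX : selfadjoint X) (X3 : cnorm X <= 3) (t1 : `|t| <= 1).

Let T : A := (4^-1%:C)%C *: (X - scal t).
Let s : A := sgn T.
Local Notation P := (spp t X).

Let saT : selfadjoint T.
Proof. by apply/selfadjointZ/selfadjointB => //; exact: scal_sa. Qed.

Let T1 : cnorm T <= 1.
Proof.
rewrite cnormZr ger0_norm ?invr_ge0 // ler_pdivrMl // mulr1.
apply: le_trans (cnormB_le _ _) _; rewrite cnorm_scal.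
by move: X3 t1; lra.
Qed.

Let PP2 : P + P = s + s * s. Proof. exact: halveD. Qed.

Let sP : s * P = P.
Proof.
apply: halve_inj; rewrite -mulrDr PP2 mulrDr mulrA sgn_cube //.
by rewrite addrC.
Qed.

Lemma spp_proj : is_proj P.
Proof.
have ss := sgn_sa saT T1.
split.
  by apply/selfadjointZ/selfadjointD => //; exact: selfadjointM.
apply: halve_inj; rewrite -mulrDl PP2 mulrDl -mulrA sP sP //.
Qed.

Lemma spp_comm b : b * X = X * b -> b * P = P * b.
Proof.
move=> bX; have bs : b * s = s * b.
  apply: sgn_comm => //; rewrite -scalerAr -scalerAl; congr (_ *: _).
  by rewrite mulrBr mulrBl bX scalC.
by rewrite /spp -scalerAr -scalerAl mulrDr mulrDl mulrA bs -!mulrA bs.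
Qed.

Let rip_T y : rip (vn_op T y) y = 4^-1 * (rip (vn_op X y) y - t * hnorm y ^+ 2).
Proof. by rewrite opZr ripZl opB ripBl op_scal ripZl hnorm_sq. Qed.

Lemma spp_ge : form_ge t X P.
Proof.
move=> x; set y := vn_op P x.
have : 0 <= rip (vn_op T y) y.
  rewrite (_ : vn_op T y = vn_op (s * T) y); first exact: sgn_abs.
  by rewrite /y -!vn_opM -sgn_self // -[in RHS]mulrA sP.
by rewrite rip_T pmulr_rge0 ?invr_gt0 // subr_ge0.
Qed.

Lemma spp_le : form_ge (- t) (- X) (1 - P).
Proof.
move=> x; set y := vn_op (1 - P) x.
have : rip (vn_op T y) y <= 0.
  rewrite (_ : vn_op T y = - vn_op (s * T) y).
    by rewrite ripNl oppr_le0; exact: sgn_abs.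
  rewrite /y -!vn_opM -opN; congr (vn_op _ x).
  rewrite -sgn_self // -[T * s * _]mulrA -mulrN -[X in X * (1 - P)](sgn_supp saT T1).
  rewrite -!mulrA; congr (T * _).
  rewrite mulrBr mulr1 sP !mulrBr sP opprB; apply/eqP.
  by rewrite subr_eq addrAC PP2 addrAC subrr add0r.
rewrite rip_T pmulr_rle0 ?invr_gt0 // opN ripNl mulNr lerN2; lra.
Qed.

Lemma spp_sym (phi : A -> A) : symmetry_map phi -> weakly_continuous phi ->
  phi P = spp t (phi X).
Proof.
move=> sphi wphi; have e : phi s = sgn ((4^-1%:C)%C *: (phi X - scal t)).
  rewrite sgn_sym // /T (symmetry_scale_real sphi) symB //.
  by rewrite (symmetry_scale_real sphi t) (symmetry_one sphi).
by rewrite /spp -e (symmetry_scale_real sphi) (symmetry_add sphi) sym_sq.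
Qed.

End Theory.
End SpectralProjection.
Arguments scal {R A} r.

(** * Pairs of nearby or nearly orthogonal projections *)

Section Geometry.
Variables (R : realType) (A : vonNeumannAlgebra R).
Local Notation H := (vn_space A).
Implicit Types (a b c X L T P Q E F : A) (x y : H) (r t k : R).

Lemma cnormM_bound a b (p q : R) : cnorm a <= p -> cnorm b <= q -> cnorm (a * b) <= p * q.
Proof.
move=> ap bq; apply: le_trans (cnormM_le _ _) _.
by apply: ler_pM => //; exact: cnorm_ge0.
Qed.

Lemma cnormM_proj P a : is_proj P -> cnorm (P * a) <= cnorm a.
Proof.
by move=> /proj_norm P1; rewrite -[leRHS]mul1r; exact: cnormM_bound.
Qed.

Lemma cnorm_mul_proj P a : is_proj P -> cnorm (a * P) <= cnorm a.
Proof.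
by move=> /proj_norm P1; rewrite -[leRHS]mulr1; exact: cnormM_bound.
Qed.

Lemma cnormD_bound a b (p q : R) : cnorm a <= p -> cnorm b <= q -> cnorm (a + b) <= p + q.
Proof. by move=> ap bq; apply: le_trans (cnormD_le _ _) _; exact: lerD. Qed.

Lemma cnormB_bound a b (p q : R) : cnorm a <= p -> cnorm b <= q -> cnorm (a - b) <= p + q.
Proof. by rewrite -(cnormN b); exact: cnormD_bound. Qed.

(** A Davis-Kahan bound.  [X] is above [t] on the range of [E] and [- L] is
    below [- t] on that of [F]; these operators are close and their spectral
    parts are [2 * t] apart.  With [Z := E * F], compare norms in
    [(X + 3) Z = E (X + L) F + Z (3 - L)]: the left side is at least
    [(t + 3) |Z|], the last term at most [(3 - t) |Z|]. *)
Lemma almost_orthogonal X L E F t : selfadjoint X -> selfadjoint L ->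
  cnorm L <= 3 -> is_proj E -> is_proj F -> E * X = X * E -> F * L = L * F ->
  form_ge t X E -> form_ge t L F -> 0 < t -> t <= 3 -> cnorm (X + L) <= 2 * t ^+ 2 ->
  cnorm (E * F) <= t.
Proof.
move=> sX sL L3 pE pF EX FL hE hF t0 t3 hXL.
have [sE EE] := pE; have [sF FF] := pF.
(* The shift [3] bounds the norm of [L], so that [3 - L] is positive. *)
have h1 : (t + 3) * cnorm (E * F) <= cnorm ((X + scal 3) * (E * F)).
  apply: (@form_ge_norm _ _ _ _ E); last by rewrite mulrA EE.
  by apply: form_geD => //; exact: form_ge_scal.
have h2 : cnorm (F * (scal 3 - L) * F) <= 3 - t.
  apply: numerical_radius.
  - by apply: selfadjoint_conj => //; apply: selfadjointB => //; exact: scal_sa.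
  - by rewrite subr_ge0.
  - move=> x; rewrite !vn_opM rip_op sF opB op_scal ripBl ripZl -hnorm_sq.
    apply: (@le_trans _ _ ((3 - t) * hnorm (vn_op F x) ^+ 2)).
      by rewrite mulrBl lerD2l lerN2; exact: hF.
    rewrite ler_wpM2l ?subr_ge0 // lerXn2r ?nnegrE ?hnorm_ge0 //; exact: hnorm_proj.
  - move=> x; apply: (@le_trans _ _ 0).
      by rewrite oppr_le0 mulr_ge0 ?subr_ge0 ?sqr_ge0.
    exact: positive_conj (positive_norm sL L3) x.
have e : (X + scal 3) * (E * F) = E * (X + L) * F + (E * F) * (F * (scal 3 - L) * F).
  have c3 : F * (scal 3 - L) = (scal 3 - L) * F by rewrite mulrBr mulrBl FL scalC.
  have -> : E * F * (F * (scal 3 - L) * F) = E * F * (scal 3 - L).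
    by rewrite -[F * _ * F]mulrA -c3 !mulrA -(mulrA E) FF -(mulrA E) FF.
  have -> : (X + scal 3) * (E * F) = X * E * F + scal 3 * (E * F) by ncring.
  have -> : E * (X + L) * F + E * F * (scal 3 - L) =
            E * X * F + E * (L * F) + E * F * scal 3 - E * (F * L) by ncring.
  by rewrite EX FL scalC; ncring.
have h3 : cnorm (E * (X + L) * F) <= 2 * t ^+ 2.
  by apply: le_trans (cnorm_mul_proj _ pF) _; apply: le_trans (cnormM_proj _ pE) _.
have h4 : (t + 3) * cnorm (E * F) <= 2 * t ^+ 2 + cnorm (E * F) * (3 - t).
  apply: le_trans h1 _; rewrite e; apply: cnormD_bound => //.
  exact: cnormM_bound.
rewrite -(ler_pM2l t0); nra.
Qed.

Lemma mul_intertwine P Q a b : P * a = a * P -> P * b = b * P -> P * (a * b) = (a * b) * P.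
Proof. by move=> h1 h2; rewrite mulrA h1 -mulrA h2 mulrA. Qed.

Section NearOrthogonal.
Variables (E F : A) (t : R).
Hypotheses (pE : is_proj E) (pF : is_proj F) (EFt : cnorm (E * F) <= t).

Local Notation T := (E - F).
Local Notation Q := (spp 2^-1 (E - F)).

Lemma sub_proj_sa : selfadjoint T.
Proof. by apply: selfadjointB; [case: pE|case: pF]. Qed.

Lemma sub_proj_norm : cnorm T <= 2.
Proof. by apply: cnormB_bound; exact: proj_norm. Qed.

Let sT := sub_proj_sa.
Let T3 : cnorm T <= 3.
Proof. by apply: le_trans sub_proj_norm _; lra. Qed.
Let h1 : `|2^-1 : R| <= 1.
Proof. by rewrite ger0_norm ?invr_ge0 // invf_le1 //; lra. Qed.

(** If [E * F] vanished, [T := E - F] would have spectrum in [{-1, 0, 1}] and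
    [Q = E = (T + T ^+ 2) / 2].  In general [D := T - T ^+ 3] is of order
    [t ^+ 2].  On the range of [Q], where [T >= 1/2], one divides
    [T (1 + T) (2 - T - T ^+ 2) = D (2 + T)] by [T (1 + T)]; on its complement,
    where [T <= 1/2], one divides [(1 - T) (T + T ^+ 2) = D] by [1 - T]. *)
Lemma near_projection : cnorm (Q - E) <= t + 10 * t ^+ 2.
Proof.
have [sE EE] := pE; have [sF FF] := pF.
have t0 : 0 <= t by apply: le_trans EFt; exact: cnorm_ge0.
have pQ : is_proj Q by exact: spp_proj.
have [sQ QQ] := pQ.
have QT : Q * T = T * Q by rewrite (spp_comm sT T3 h1).
pose D := T - T * T * T.
have D2 : cnorm D <= 2 * t ^+ 2.
  have -> : D = E * F * star (E * F) - star (E * F) * (E * F).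
    rewrite /D starM sE sF -!mulrA (mulrA F F) FF (mulrA E E) EE.
    have -> : (E - F) * ((E - F) * (E - F)) =
      E * E * E - E * E * F - E * F * E + E * (F * F)
      - F * (E * E) + F * E * F + F * F * E - F * F * F by ncring.
    by rewrite !EE !FF; ncring.
  have -> : 2 * t ^+ 2 = t ^+ 2 + t ^+ 2 by ring.
  apply: cnormB_bound; rewrite ?cnorm_star_mul ?cnorm_mul_star.
    by rewrite lerXn2r ?nnegrE ?cnorm_ge0.
  by rewrite lerXn2r ?nnegrE ?cnorm_ge0.
pose c1 := (1 + 1 - T - T * T) * Q.
have Qc a : Q * a = a * Q -> Q * (a * Q) = a * Q by move=> h; rewrite mulrA h -mulrA QQ.
have c1b : cnorm c1 <= 16 * t ^+ 2.
  have QTT : Q * (T * T) = T * T * Q by exact: mul_intertwine.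
  have Qp : Q * (1 + 1 - T - T * T) = (1 + 1 - T - T * T) * Q.
    apply: (commrB (commrB (commrD (commr1 Q) (commr1 Q)) _)) => //.
  have hT : form_ge 2^-1 T Q by exact: spp_ge.
  have l1 : 2^-1 * cnorm c1 <= cnorm (T * c1).
    by apply: form_ge_norm hT _; exact: Qc.
  have l2 : 1 * cnorm (T * c1) <= cnorm ((1 + T) * (T * c1)).
    apply: (@form_ge_norm _ _ _ _ Q); last first.
      by rewrite /c1 (mulrA T); apply: Qc; exact: mul_intertwine.
    move=> x; rewrite vn_opD ripDl vn_op1 -hnorm_sq mul1r lerDl.
    by apply: le_trans (hT x); rewrite mulr_ge0 ?sqr_ge0 // invr_ge0.
  have l3 : cnorm ((1 + T) * (T * c1)) <= 2 * t ^+ 2 * 4.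
    have -> : (1 + T) * (T * c1) = D * ((1 + 1 + T) * Q) by rewrite /c1 /D; ncring.
    apply: cnormM_bound => //; apply: le_trans (cnorm_mul_proj _ pQ) _.
    have -> : 4 = 1 + 1 + 2 :> R by ring.
    apply: cnormD_bound; last exact: sub_proj_norm.
    by apply: cnormD_bound; rewrite cnorm1.
  rewrite mul1r in l2; have := le_trans l1 (le_trans l2 l3); lra.
pose c2 := (T * T + T) * (1 - Q).
have c2b : cnorm c2 <= 4 * t ^+ 2.
  have Q'T : (1 - Q) * T = T * (1 - Q).
    by rewrite (mulrBl T) (mulrBr T 1) QT mul1r mulr1.
  have l1 : 2^-1 * cnorm c2 <= cnorm ((1 - T) * c2).
    apply: (@form_ge_norm _ _ _ _ (1 - Q)).
      move=> x; have := spp_le sT T3 h1 x; set y := vn_op (1 - Q) x.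
      rewrite (opN T) ripNl (opB 1 T) vn_op1 ripBl -hnorm_sq; lra.
    have [_ Q'Q'] := projC pQ.
    have Q'c : GRing.comm (1 - Q) (T * T + T).
      by apply: commrD => //; exact: commrM.
    by rewrite /c2 mulrA Q'c -mulrA Q'Q'.
  have l2 : cnorm ((1 - T) * c2) <= 2 * t ^+ 2.
    have -> : (1 - T) * c2 = D * (1 - Q) by rewrite /c2 /D; ncring.
    apply: le_trans (cnorm_mul_proj _ (projC pQ)) _; exact: D2.
  have := le_trans l1 l2; lra.
have e : (Q - E) + (Q - E) = c1 - c2 - (E * F + F * E).
  have -> : c1 - c2 = Q + Q - T * T - T by rewrite /c1 /c2; ncring.
  have -> : T * T = E * E - E * F - F * E + F * F by ncring.
  by rewrite EE FF; ncring.
have n2 : cnorm ((Q - E) + (Q - E)) = 2 * cnorm (Q - E).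
  have := cnormZr 2 (Q - E); rewrite ger0_norm // => <-.
  by rewrite rmorphMn /= rmorph1 scaler_nat mulr2n.
have FEt : cnorm (F * E) <= t by rewrite -cnorm_star starM sE sF.
have := cnormB_bound (cnormB_bound c1b c2b) (cnormD_bound EFt FEt).
rewrite -e n2; lra.
Qed.

(** A vector in both ranges would have [T >= 1/2] and [T <= - 1/2]. *)
Lemma spp_opp_orth : Q * spp 2^-1 (- T) = 0.
Proof.
have sT' : selfadjoint (- T) by exact: selfadjointN.
have T3' : cnorm (- T) <= 3 by rewrite cnormN.
set Q' := spp 2^-1 (- T).
have QQ' : Q * Q' = Q' * Q.
  apply: (spp_comm sT' T3' h1).
  by rewrite mulrN mulNr; congr (- _); apply/esym; apply: (spp_comm sT T3 h1).
apply: op_inj => x; rewrite op0; apply: hnorm_eq0; apply/eqP.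
rewrite -sqrf_eq0 eq_le sqr_ge0 andbT.
have a1 := spp_ge sT T3 h1 (vn_op Q' x).
have a2 := spp_ge sT' T3' h1 (vn_op Q x).
rewrite -/Q' -(vn_opM Q' Q) -QQ' opN ripNl in a2.
rewrite -(vn_opM Q Q') in a1; lra.
Qed.

End NearOrthogonal.

(** The self-adjoint unitary of the polar decomposition of [E + Q - 1].  For two
    lines of the plane this is the reflection across their bisector, which
    exchanges them. *)
Definition swap E Q : A := sgn ((4^-1%:C)%C *: (E + Q - 1)).

Section Swap.
Variables (E Q : A) (q : R).
Hypotheses (pE : is_proj E) (pQ : is_proj Q) (QEq : cnorm (Q - E) <= q) (q1 : q < 1).
Local Notation U := (swap E Q).
Let B := E + Q - 1.
Let T := ((4^-1%:C)%C *: B).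

Let q0 : 0 <= q. Proof. by apply: le_trans QEq; exact: cnorm_ge0. Qed.

Let sB : selfadjoint B.
Proof.
apply: selfadjointB; last exact: selfadjoint1.
by apply: selfadjointD; [case: pE|case: pQ].
Qed.

Let sT : selfadjoint T. Proof. exact: selfadjointZ. Qed.

Let T1 : cnorm T <= 1.
Proof.
rewrite cnormZr ger0_norm ?invr_ge0 // ler_pdivrMl // mulr1.
have -> : 4 = 1 + 1 + 2 :> R by ring.
apply: cnormB_bound; last by rewrite cnorm1 ler1n.
by apply: cnormD_bound; exact: proj_norm.
Qed.

Lemma swap_sa : selfadjoint U. Proof. exact: sgn_sa. Qed.

Let BU : B * U = U * B.
Proof.
by apply: sgn_comm => //; rewrite -scalerAr -scalerAl.
Qed.

Let BUU : B * (U * U) = B.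
Proof.
have := sgn_supp sT T1; rewrite /T -scalerAl => /(congr1 (fun a => (4%:C)%C *: a)).
by rewrite !scalerA -rmorphM mulfV ?pnatr_eq0 // !scale1r.
Qed.

Let BB : B * B = 1 - (Q - E) * (Q - E).
Proof.
have [_ EE] := pE; have [_ QQ] := pQ.
have -> : B * B = E * E + E * Q + Q * E + Q * Q - E - E - Q - Q + 1 by rewrite /B; ncring.
have -> : (Q - E) * (Q - E) = Q * Q - Q * E - E * Q + E * E by ncring.
by rewrite EE QQ; ncring.
Qed.

Let QE2 : cnorm ((Q - E) * (Q - E)) <= q ^+ 2.
Proof. by rewrite expr2; exact: cnormM_bound. Qed.

(** The square of [E + Q - 1] is [1 - (Q - E) ^+ 2], so it has no kernel. *)
Lemma swap_sq : U * U = 1.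
Proof.
apply/eqP; rewrite eq_sym -subr_eq0; apply/eqP/cnorm_eq0; set K := 1 - U * U.
have BK : B * K = 0 by rewrite mulrBr mulr1 BUU subrr.
have KK : K = (Q - E) * (Q - E) * K.
  by apply/eqP; rewrite -subr_eq0 -[X in X - _]mul1r -mulrBl -BB -mulrA BK mulr0.
have : cnorm K <= q ^+ 2 * cnorm K by rewrite {1}KK; exact: cnormM_bound.
have := cnorm_ge0 K; have : q ^+ 2 < 1 by rewrite expr_lt1.
nra.
Qed.

Lemma swap_norm : cnorm U <= 1.
Proof.
have := cnorm_star_mul U; rewrite swap_sa swap_sq cnorm1 => h.
have := cnorm_ge0 U; nra.
Qed.

(** [U] commutes with [E + Q] and, being an odd function of [B], anticommutes
    with [Q - E], because [B] does. *)
Lemma swap_intertwine : U * E = Q * U.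
Proof.
have [_ EE] := pE; have [_ QQ] := pQ.
have anti : (Q - E) * B = - B * (Q - E).
  have -> : (Q - E) * B = Q * E + Q * Q - Q - E * E - E * Q + E by rewrite /B; ncring.
  have -> : - B * (Q - E) = E * E - E * Q - Q * Q + Q * E + Q - E by rewrite /B; ncring.
  by rewrite EE QQ; ncring.
have e1 : (Q - E) * U = - U * (Q - E).
  rewrite -[- U](sgn_opp sT T1); apply: sgn_intertwine => //.
  - exact: selfadjointN.
  - by rewrite cnormN.
  - by rewrite -scalerN -scalerAr -scalerAl anti.
have e2 : (E + Q) * U = U * (E + Q).
  have -> : E + Q = B + 1 by rewrite /B subrK.
  by rewrite mulrDl mulrDr BU mul1r mulr1.
apply: halve_inj.
have -> : U * E + U * E = U * (E + Q) + (- U * (Q - E)) by ncring.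
by rewrite -e1 -e2; ncring.
Qed.

Lemma swap_sym (phi : A -> A) : symmetry_map phi -> weakly_continuous phi ->
  phi U = swap (phi E) (phi Q).
Proof.
move=> sphi wphi; rewrite /swap sgn_sym // (symmetry_scale_real sphi) symB //.
by rewrite (symmetry_add sphi) (symmetry_one sphi).
Qed.

(** [U] is close to [B] because [1 - U * B] is controlled by
    [1 - B * B = (1 + U * B) (1 - U * B)], and [B * E - E = (Q - E) * E]. *)
Lemma swap_near : cnorm (U * E - E) <= q + q ^+ 2.
Proof.
have [_ EE] := pE; have [_ QQ] := pQ.
have posUB : positive (U * B).
  have := positiveZ (ler0n R 4) (sgn_abs sT T1).
  by rewrite /T -scalerAr scalerA -rmorphM mulfV ?pnatr_eq0 // scale1r.
have l1 : 1 * cnorm (1 - U * B) <= cnorm ((1 + U * B) * (1 - U * B)).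
  apply: (@form_ge_norm _ _ _ _ 1); last by rewrite mul1r.
  by move=> x; rewrite vn_opD ripDl !vn_op1 -hnorm_sq mul1r lerDl.
have e : (1 + U * B) * (1 - U * B) = (Q - E) * (Q - E).
  have -> : (1 + U * B) * (1 - U * B) = 1 - U * (B * U) * B by ncring.
  by rewrite BU mulrA swap_sq mul1r BB opprB addrC subrK.
have l2 : cnorm (U - B) <= q ^+ 2.
  have -> : U - B = U * (1 - U * B) by rewrite mulrBr mulr1 mulrA swap_sq mul1r.
  rewrite -[leRHS]mul1r; apply: cnormM_bound; first exact: swap_norm.
  by move: l1; rewrite mul1r e => /le_trans; apply.
have -> : U * E - E = (Q - E) * E + (U - B) * E.
  have -> : (U - B) * E = U * E - E * E - Q * E + E by rewrite /B; ncring.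
  by rewrite mulrBl EE; ncring.
apply: cnormD_bound.
  by apply: le_trans (cnorm_mul_proj _ pE) _.
by apply: le_trans (cnorm_mul_proj _ pE) _.
Qed.

End Swap.
End Geometry.

(** * Normal elements and antisymmetrization *)

Section NormalSums.
Variables (R : realType) (A : cstarAlgType R).
Implicit Types a b P : A.

Lemma is_normalD a b : is_normal a -> is_normal b ->
  star a * b = 0 -> a * star b = 0 -> is_normal (a + b).
Proof.
rewrite /is_normal => na nb ab1 ab2.
have ba1 : star b * a = 0 by rewrite -(starK a) -starM ab1 star0.
have ba2 : b * star a = 0 by rewrite -(starK b) -starM ab2 star0.
by rewrite starD !mulrDl !mulrDr ab1 ab2 ba1 ba2 na nb.
Qed.

Lemma is_normal_skew a : star a = - a -> is_normal a.
Proof. by rewrite /is_normal => ->; rewrite mulrN mulNr. Qed.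

Lemma is_normal_sym (phi : A -> A) a : symmetry_map phi -> is_normal a ->
  is_normal (phi a).
Proof.
rewrite /is_normal => sphi na; rewrite -(symmetry_star sphi).
exact: sym_commutes.
Qed.

Lemma is_normalN a : is_normal a -> is_normal (- a).
Proof. by rewrite /is_normal starN !mulrNN. Qed.
End NormalSums.

Section Core.
Variables (R : realType) (A : vonNeumannAlgebra R).
Local Notation H := (vn_space A).
Implicit Types (a P Q E F X : A) (x y : H).

(** Split [y] by [E]: the component in the range of [E] is small, since [y] is
    orthogonal to the nearby [Q], and on the other one [X] is at most [t]. *)
Lemma compression_upper (X X0 E Q : A) (t d q : R) :
  is_proj E -> is_proj Q -> E * X = X * E -> cnorm X <= 2 -> 
  form_ge (- t) (- X) (1 - E) -> 0 <= t ->
  cnorm (X0 - X) <= d -> cnorm (Q - E) <= q ->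
  forall y, vn_op Q y = 0 ->
  rip (vn_op X0 y) y <= (t + d + 2 * q ^+ 2) * hnorm y ^+ 2.
Proof.
move=> pE pQ EX X2 hX t0 X0X QEq y Qy.
have [sE EE] := pE.
have q0 : 0 <= q by apply: le_trans QEq; exact: cnorm_ge0.
have Ey : hnorm (vn_op E y) <= q * hnorm y.
  have -> : vn_op E y = - vn_op (Q - E) y by rewrite opB Qy sub0r opprK.
  rewrite hnorm_opp; apply: le_trans (hnorm_op _ _) _.
  by rewrite ler_wpM2r ?hnorm_ge0.
have split_X : rip (vn_op X y) y =
    rip (vn_op X (vn_op E y)) (vn_op E y) + rip (vn_op X (vn_op (1 - E) y)) (vn_op (1 - E) y).
  have e : X = E * X * E + (1 - E) * X * (1 - E).
    have -> : E * X * E + (1 - E) * X * (1 - E) =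
      X + (E * X) * E + (E * X) * E - E * X - X * E by ncring.
    by rewrite EX -mulrA EE; ncring.
  rewrite [X in rip (vn_op X y)]e vn_opD ripDl !vn_opM !(rip_op _ _ y) sE.
  by have [-> _] := projC pE.
have h1 : rip (vn_op X (vn_op E y)) (vn_op E y) <= 2 * (q * hnorm y) ^+ 2.
  apply: le_trans (rip_CS _ _) _.
  apply: (@le_trans _ _ (2 * hnorm (vn_op E y) ^+ 2)).
    rewrite expr2 mulrA ler_wpM2r ?hnorm_ge0 //; apply: le_trans (hnorm_op _ _) _.
    by rewrite ler_wpM2r ?hnorm_ge0.
  by rewrite ler_wpM2l // lerXn2r ?nnegrE ?mulr_ge0 ?hnorm_ge0.
have h2 : rip (vn_op X (vn_op (1 - E) y)) (vn_op (1 - E) y) <= t * hnorm y ^+ 2.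
  have := hX y; rewrite opN ripNl mulNr lerN2 => /le_trans; apply.
  by rewrite ler_wpM2l // lerXn2r ?nnegrE ?hnorm_ge0 //; apply: hnorm_proj; exact: projC.
have h3 : rip (vn_op X0 y) y <= rip (vn_op X y) y + d * hnorm y ^+ 2.
  rewrite -lerBlDl -ripBl -opB; apply: le_trans (rip_CS _ _) _.
  rewrite expr2 mulrA ler_wpM2r ?hnorm_ge0 //; apply: le_trans (hnorm_op _ _) _.
  by rewrite ler_wpM2r ?hnorm_ge0.
rewrite split_X in h3; rewrite exprMn in h1; lra.
Qed.

Definition re_part a : A := halve (a + star a).
Definition skew_part a : A := halve (a - star a).

Lemma re_skew a : a = re_part a + skew_part a.
Proof.
rewrite /re_part /skew_part /halve -scalerDr addrACA subrr addr0 scalerDr.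
exact/esym/halveD.
Qed.

Lemma re_sa a : selfadjoint (re_part a).
Proof. by rewrite /selfadjoint starZr starD starK addrC. Qed.

Lemma skew_star a : star (skew_part a) = - skew_part a.
Proof. by rewrite /skew_part starZr starB starK -scalerN opprB. Qed.

Lemma re_sub a b : re_part (a - b) = re_part a - re_part b.
Proof. by rewrite /re_part /halve -scalerBr starB opprD addrACA. Qed.

Lemma cnorm_halve a : cnorm (halve a) = cnorm a / 2.
Proof. by rewrite cnormZr ger0_norm ?invr_ge0 // mulrC. Qed.

Lemma re_norm a : cnorm (re_part a) <= cnorm a.
Proof.
rewrite cnorm_halve; have := cnormD_le a (star a); rewrite cnorm_star; lra.
Qed.

Lemma sym_halve (phi : A -> A) a : symmetry_map phi -> phi (halve a) = halve (phi a).
Proof. by move=> sphi; exact: symmetry_scale_real. Qed.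

Lemma re_sym (phi : A -> A) a : symmetry_map phi -> phi (re_part a) = re_part (phi a).
Proof. by move=> sphi; rewrite sym_halve // (symmetry_add sphi) (symmetry_star sphi). Qed.

Lemma skew_sym (phi : A -> A) a : symmetry_map phi -> phi (skew_part a) = skew_part (phi a).
Proof. by move=> sphi; rewrite sym_halve // symB // (symmetry_star sphi). Qed.

Lemma re_partN a : re_part (- a) = - re_part a.
Proof. by rewrite /re_part starN -opprD /halve scalerN. Qed.

Lemma skew_partN a : skew_part (- a) = - skew_part a.
Proof. by rewrite /skew_part starN opprK /halve -scalerN opprB addrC. Qed.

Section Construction.
Variables (phi : A -> A) (b N : A) (t : R).
Hypotheses (sphi : symmetry_map phi) (wphi : weakly_continuous phi).
Hypotheses (phi2 : forall a, phi (phi a) = a) (phib : phi b = - b).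
Hypotheses (b1 : cnorm b <= 1) (Nn : is_normal N).
Hypotheses (t0 : 0 < t) (t1 : t <= 90^-1) (Nb : cnorm (N - b) <= t ^+ 2).

Let X := re_part N.
Let L := phi X.
Let E := spp t X.
Let F := phi E.
Let Q := spp 2^-1 (E - F).
Let Q' := phi Q.
Let U := swap E Q.
Let m := U * (E * N * E) * U.
Let K := 1 - Q - Q'.

(** [m] is the part of [N] where its real part exceeds [t], carried from the range
    of [E] to that of [Q]; its opposite image under [phi] lives on the range of
    [phi Q].  On the remaining subspace [K] the real part is small and is
    dropped, which leaves a normal element already antisymmetric. *)
Definition antisym_normal : A := m - phi m + K * skew_part b * K.

Local Notation c := antisym_normal.


Let tt : t ^+ 2 <= t / 90.
Proof. by rewrite expr2 ler_wpM2l // ltW. Qed.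

Let N2 : cnorm N <= 2.
Proof.
rewrite -(subrK b N); apply: le_trans (cnormD_le _ _) _.
by move: t1 tt Nb b1 t0; lra.
Qed.

Let sX : selfadjoint X. Proof. exact: re_sa. Qed.
Let X2 : cnorm X <= 2. Proof. by apply: le_trans N2; exact: re_norm. Qed.
Let X3 : cnorm X <= 3. Proof. by apply: le_trans X2 _; lra. Qed.
Let tle1 : `|t| <= 1. Proof. by rewrite gtr0_norm //; move: t1 t0; lra. Qed.
Let sL : selfadjoint L.
Proof. by rewrite /selfadjoint -(symmetry_star sphi) [star X]sX. Qed.
Let L2 : cnorm L <= 2. Proof. by apply: le_trans X2; exact: sym_norm_le. Qed.
Let L3 : cnorm L <= 3. Proof. by apply: le_trans L2 _; lra. Qed.

Let FE : F = spp t L. Proof. exact: spp_sym. Qed.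
Let pE : is_proj E. Proof. exact: spp_proj. Qed.
Let pF : is_proj F. Proof. by rewrite FE; exact: spp_proj. Qed.
Let EX : E * X = X * E. Proof. exact/esym/spp_comm. Qed.
Let FL : F * L = L * F. Proof. by rewrite FE; exact/esym/spp_comm. Qed.
Let NE : N * E = E * N.
Proof.
apply: spp_comm => //; rewrite /X /re_part /halve -scalerAr -scalerAl.
by rewrite mulrDr mulrDl -[N * star N]Nn.
Qed.

Let b_re : phi (re_part b) = - re_part b.
Proof. by rewrite re_sym // phib re_partN. Qed.

Let Xb : cnorm (X - re_part b) <= t ^+ 2.
Proof. by rewrite -re_sub; apply: le_trans Nb; exact: re_norm. Qed.

Let Lb : cnorm (L + re_part b) <= t ^+ 2.
Proof.
rewrite -[re_part b]opprK -b_re -symB //; apply: le_trans Xb; exact: sym_norm_le.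
Qed.

Let XL : cnorm (X + L) <= 2 * t ^+ 2.
Proof.
have -> : X + L = (X - re_part b) + (L + re_part b) by rewrite addrACA addNr addr0.
by have := cnormD_bound Xb Lb; lra.
Qed.

Let EFt : cnorm (E * F) <= t.
Proof.
apply: (@almost_orthogonal _ _ X L) => //.
- exact: spp_ge.
- by rewrite FE; exact: spp_ge.
- by move: t1 t0; lra.
Qed.

Let phiT : phi (E - F) = - (E - F).
Proof. by rewrite symB // /F phi2 opprB. Qed.

Let pT3 : cnorm (E - F) <= 3.
Proof. by apply: le_trans (sub_proj_norm pE pF) _; lra. Qed.
Let sT : selfadjoint (E - F). Proof. exact: sub_proj_sa. Qed.
Let h1 : `|2^-1 : R| <= 1.
Proof. by rewrite ger0_norm ?invr_ge0 // invf_le1 //; lra. Qed.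

Let Q'E : Q' = spp 2^-1 (- (E - F)).
Proof. by rewrite /Q' /Q spp_sym // phiT. Qed.
Let pQ : is_proj Q. Proof. exact: spp_proj. Qed.
Let pQ' : is_proj Q'.
Proof.
have [sQ QQ] := pQ.
by split; [rewrite /selfadjoint -(symmetry_star sphi) sQ|rewrite -sym_sq // QQ].
Qed.
Let QQ'0 : Q * Q' = 0. Proof. by rewrite Q'E; exact: spp_opp_orth. Qed.
Let Q'Q0 : Q' * Q = 0.
Proof.
by have [sQ _] := pQ; have [sQ' _] := pQ'; rewrite -[Q]sQ -[Q']sQ' -starM QQ'0 star0.
Qed.

Let q := t + 10 * t ^+ 2.
Let QE : cnorm (Q - E) <= q. Proof. exact: near_projection. Qed.
Let q0 : 0 <= q. Proof. by apply: le_trans QE; exact: cnorm_ge0. Qed.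
Let qle : q <= 10 / 9 * t. Proof. by rewrite /q; move: tt; lra. Qed.
Let q1 : q < 1. Proof. by move: qle t1 t0; lra. Qed.
Let qq : q ^+ 2 <= t / 50.
Proof.
have : q ^+ 2 <= q * (10 / 9 * t) by rewrite expr2 ler_wpM2l.
have : q * (10 / 9 * t) <= (10 / 9 * 90^-1) * (10 / 9 * t).
  rewrite ler_wpM2r //; first by move: t0; lra.
  by move: qle t1; lra.
by move: t0; lra.
Qed.

Let sU : selfadjoint U. Proof. exact: swap_sa. Qed.
Let UU : U * U = 1. Proof. exact: (swap_sq pE pQ QE). Qed.
Let UE : U * E = Q * U. Proof. exact: swap_intertwine. Qed.
Let EU : E * U = U * Q.
Proof.
have [sE _] := pE; have [sQ _] := pQ.
by rewrite -[E]sE -[U]sU -[Q]sQ -!starM UE.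
Qed.

Let pK : is_proj K.
Proof.
have [sQ QQ] := pQ; have [sQ' QQ'] := pQ'; split.
  by do 2?apply: selfadjointB => //; exact: selfadjoint1.
have -> : K * K = K - Q - Q' + Q * Q + Q * Q' + Q' * Q + Q' * Q' by rewrite /K; ncring.
by rewrite QQ QQ' QQ'0 Q'Q0; ncring.
Qed.

Let mE : m = U * E * N * (E * U).
Proof. by rewrite /m !mulrA. Qed.

Let Qm : Q * m = m.
Proof. by have [_ QQ] := pQ; rewrite mE UE !mulrA QQ. Qed.
Let mQ : m * Q = m.
Proof. by have [_ QQ] := pQ; rewrite mE EU -!mulrA QQ. Qed.

Let Q'm : Q' * phi m = phi m.
Proof.
have [h|h] := symmetry_mul sphi; first by rewrite -h Qm.
by rewrite -h mQ.
Qed.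
Let mQ' : phi m * Q' = phi m.
Proof.
have [h|h] := symmetry_mul sphi; first by rewrite -h mQ.
by rewrite -h Qm.
Qed.

Let phiK : phi K = K.
Proof.
by rewrite /K !symB // (symmetry_one sphi) /Q' phi2 addrAC.
Qed.

(** Every ingredient is a sign, or a palindromic product, of elements fixed by
    [psi]; such products do not distinguish multiplicative from
    anti-multiplicative maps. *)
Lemma antisym_normal_fixed (psi : A -> A) : symmetry_map psi -> weakly_continuous psi ->
  (forall a, phi (psi a) = psi (phi a)) -> psi b = b -> psi N = N -> psi c = c.
Proof.
move=> spsi wpsi comm psib psiN.
have psiX : psi X = X by rewrite re_sym // psiN.
have psiE : psi E = E by rewrite spp_sym // psiX.
have psiF : psi F = F by rewrite -comm psiE.
have psiQ : psi Q = Q.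
  by rewrite (spp_sym sT pT3 h1 spsi wpsi) (symB spsi) psiE psiF.
have psiQ' : psi Q' = Q' by rewrite -comm psiQ.
have psiU : psi U = U by rewrite swap_sym // psiE psiQ.
have psim : psi m = m by rewrite !(sym_pal spsi) psiE psiN psiU.
have psiK : psi K = K by rewrite !(symB spsi) (symmetry_one spsi) psiQ psiQ'.
rewrite (symmetry_add spsi) (symB spsi) psim -comm psim (sym_pal spsi) psiK.
by rewrite (skew_sym _ spsi) psib.
Qed.

Lemma antisym_normal_anti : phi c = - c.
Proof.
rewrite (symmetry_add sphi) (symB sphi) phi2 (sym_pal sphi K) phiK (skew_sym _ sphi) phib.
by rewrite skew_partN mulrN mulNr opprD opprB.
Qed.

(** Three normal blocks supported on mutually orthogonal projections. *)
Lemma antisym_normal_normal : is_normal c.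
Proof.
have [sE EE] := pE; have [sQ QQ] := pQ; have [sQ' QQ'] := pQ'; have [sK KK] := pK.
have QK : Q * K = 0 by rewrite !mulrBr mulr1 QQ QQ'0 subrr subr0.
have Q'K : Q' * K = 0 by rewrite !mulrBr mulr1 QQ' Q'Q0 subr0 subrr.
have smQ : star m * Q = star m by rewrite -[X in _ * X]sQ -starM Qm.
have smQ' : star (phi m) * Q' = star (phi m) by rewrite -[X in _ * X]sQ' -starM Q'm.
have Qsm : Q' * star (phi m) = star (phi m) by rewrite -[X in X * _]sQ' -starM mQ'.
have sandwich a a' : a * Q = a -> Q' * a' = a' -> a * a' = 0.
  by move=> <- <-; rewrite mulrA -(mulrA a) QQ'0 mulr0 mul0r.
have killK a P a' : a * P = a -> P * K = 0 -> a * (K * a') = 0.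
  by move=> <- PK; rewrite mulrA -(mulrA a) PK mulr0 mul0r.
have nm : is_normal m.
  have sm : star m = U * E * star N * (E * U).
    by rewrite /m !starM [star U]sU [star E]sE !mulrA.
  have sNE : star N * E = E * star N by rewrite -[in LHS]sE -starM -NE starM sE.
  have prod a a' : a' * E = E * a' ->
    U * E * a * (E * U) * (U * E * a' * (E * U)) = U * E * (a * a') * E * U.
    move=> ha; have -> : U * E * a * (E * U) * (U * E * a' * (E * U)) =
      U * E * a * (E * (U * U) * E) * a' * E * U by ncring.
    by rewrite UU mulr1 EE -(mulrA _ E a') -ha -!mulrA (mulrA E E) EE.
  by rewrite /is_normal sm mE !prod // Nn.
have nK : is_normal (K * skew_part b * K).
  by apply: is_normal_skew; rewrite !starM skew_star sK mulNr mulrN mulrA.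
apply: is_normalD => //.
- apply: is_normalD => //; first exact/is_normalN/is_normal_sym.
    by rewrite mulrN sandwich // oppr0.
  by rewrite starN mulrN sandwich // oppr0.
- by rewrite starB -mulrA mulrBl !(killK _ _ _ smQ QK, killK _ _ _ smQ' Q'K) subrr.
- rewrite !starM sK mulrBl.
  by rewrite !(killK _ _ _ mQ QK, killK _ _ _ mQ' Q'K) subrr.
Qed.

Let u := q + q ^+ 2.
Let ule : u <= 102 / 90 * t.
Proof. by rewrite /u; move: qle qq t0; lra. Qed.

Let m_near : cnorm (m - Q * b * Q) <= 4 * u + t ^+ 2 + 2 * q.
Proof.
have UEn : cnorm (U * E - E) <= u by exact: swap_near.
have EUn : cnorm (E * U - E) <= u.
  by have [sE _] := pE; rewrite -cnorm_star starB starM [star U]sU sE.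
have EQn : cnorm (E - Q) <= q by rewrite cnormBC.
have -> : m - Q * b * Q =
    ((U * E - E) * (N * (E * U)) + E * N * (E * U - E)) + E * (N - b) * E
    + ((E - Q) * (b * E) + Q * b * (E - Q)).
  by rewrite /m; ncring.
have -> : 4 * u + t ^+ 2 + 2 * q = (u * (2 * 1) + 2 * u) + t ^+ 2 + (q * 1 + 1 * q) by ring.
have U1 : cnorm U <= 1 by exact: (swap_norm pE pQ QE).
apply: cnormD_bound.
  apply: cnormD_bound.
    apply: cnormD_bound; apply: cnormM_bound => //.
      apply: cnormM_bound => //; apply: le_trans U1; exact: cnormM_proj.
    by apply: le_trans N2; exact: cnormM_proj.
  apply: le_trans Nb; apply: le_trans (cnorm_mul_proj _ pE) _; exact: cnormM_proj.
apply: cnormD_bound; apply: cnormM_bound => //.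
  by apply: le_trans b1; exact: cnorm_mul_proj.
by apply: le_trans b1; exact: cnormM_proj.
Qed.

Let m'_near : cnorm (phi m + Q' * b * Q') <= 4 * u + t ^+ 2 + 2 * q.
Proof.
apply: le_trans m_near; have := sym_norm_le sphi wphi (m - Q * b * Q).
by rewrite (symB sphi) (sym_pal sphi Q) phib mulrN mulNr opprK.
Qed.

Let off_diag : cnorm (Q * b * (1 - Q)) <= t ^+ 2 + 2 * q /\
  cnorm ((1 - Q) * b * Q) <= t ^+ 2 + 2 * q.
Proof.
have [_ EE] := pE; have pQc := projC pQ; have pEc := projC pE.
have nt : forall P S a : A, is_proj P -> is_proj S -> cnorm (P * a * S) <= cnorm a.
  move=> P S a pP pS; apply: le_trans (cnorm_mul_proj _ pS) _; exact: cnormM_proj.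
have EQn : cnorm (E - Q) <= q by rewrite cnormBC.
have Nb' : cnorm (b - N) <= t ^+ 2 by rewrite cnormBC.
have bound : t ^+ 2 + 2 * q = t ^+ 2 + (q * 1 + 1 * q) by ring.
rewrite bound; split.
  have -> : Q * b * (1 - Q) = E * (b - N) * (1 - E)
      + ((Q - E) * (b * (1 - Q)) + E * b * (E - Q)).
    have ENE0 : E * N * (1 - E) = 0 by rewrite mulrBr mulr1 -NE -mulrA EE subrr.
    transitivity (Q * b * (1 - Q) - E * N * (1 - E)); first by rewrite ENE0 subr0.
    by ncring.
  apply: cnormD_bound; first by apply: le_trans Nb'; exact: nt.
  apply: cnormD_bound; apply: cnormM_bound => //.
    by apply: le_trans b1; exact: cnorm_mul_proj.
  by apply: le_trans b1; exact: cnormM_proj.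
have -> : (1 - Q) * b * Q = (1 - E) * (b - N) * E
    + ((E - Q) * (b * Q) + (1 - E) * b * (Q - E)).
  have ENE0 : (1 - E) * N * E = 0 by rewrite -mulrA NE mulrA mulrBl mul1r EE subrr mul0r.
  transitivity ((1 - Q) * b * Q - (1 - E) * N * E); first by rewrite ENE0 subr0.
  by ncring.
apply: cnormD_bound; first by apply: le_trans Nb'; exact: nt.
apply: cnormD_bound; apply: cnormM_bound => //.
  by apply: le_trans b1; exact: cnorm_mul_proj.
by apply: le_trans b1; exact: cnormM_proj.
Qed.

Let off_diag' : cnorm (Q' * b * (1 - Q')) <= t ^+ 2 + 2 * q /\
  cnorm ((1 - Q') * b * Q') <= t ^+ 2 + 2 * q.
Proof.
have e : phi (1 - Q) = 1 - Q' by rewrite (symB sphi) (symmetry_one sphi).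
have [d1 d2] := off_diag.
have n1 := le_trans (sym_norm_le sphi wphi _) d1.
have n2 := le_trans (sym_norm_le sphi wphi _) d2.
by have [h|h] := symmetry_mul sphi; move: n1 n2;
  rewrite !h e phib ?(mulrN, mulNr) !cnormN ?mulrA.
Qed.

(** The upper bound of the form comes from the cut [E] of [X], the lower one
    from the cut [F] of [L], which is close to [- X]. *)
Let re_near : cnorm (K * re_part b * K) <= t + t ^+ 2 + 2 * q ^+ 2.
Proof.
have [sK KK] := pK; have [_ QQ] := pQ; have [_ QQ'] := pQ'.
have QK : Q * K = 0 by rewrite !mulrBr mulr1 QQ QQ'0 subrr subr0.
have Q'K : Q' * K = 0 by rewrite !mulrBr mulr1 QQ' Q'Q0 subr0 subrr.
set d := t + t ^+ 2 + 2 * q ^+ 2.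
have d0 : 0 <= d by rewrite !addr_ge0 ?sqr_ge0 ?(ltW t0) // mulr_ge0 ?sqr_ge0.
have EL : F * L = L * F by [].
have up x : rip (vn_op (re_part b) (vn_op K x)) (vn_op K x) <= d * hnorm (vn_op K x) ^+ 2.
  apply: (@compression_upper X _ E Q) => //; rewrite ?(ltW t0) //.
  - exact: spp_le.
  - by rewrite cnormBC.
  - by rewrite -vn_opM QK op0.
have dn x : rip (vn_op (- re_part b) (vn_op K x)) (vn_op K x) <= d * hnorm (vn_op K x) ^+ 2.
  apply: (@compression_upper L _ F Q') => //; rewrite ?(ltW t0) //.
  - by rewrite FE; exact: spp_le.
  - by rewrite -opprD cnormN addrC.
  - by rewrite -(symB sphi); apply: le_trans QE; exact: sym_norm_le.
  - by rewrite -vn_opM Q'K op0.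
have mono x : d * hnorm (vn_op K x) ^+ 2 <= d * hnorm x ^+ 2.
  by rewrite ler_wpM2l // lerXn2r ?nnegrE ?hnorm_ge0 //; exact: hnorm_proj.
have form x : rip (vn_op (K * re_part b * K) x) x =
    rip (vn_op (re_part b) (vn_op K x)) (vn_op K x).
  by rewrite !vn_opM rip_op sK.
apply: numerical_radius => //; first by apply: selfadjoint_conj => //; exact: re_sa.
  by move=> x; rewrite form; exact: le_trans (up x) (mono x).
move=> x; rewrite form lerNl; apply: le_trans (mono x).
by have := dn x; rewrite opN ripNl.
Qed.

(** Decompose [b] along [Q + Q' + K = 1].  The diagonal blocks of [Q] and [Q']
    are matched by [m] and [- phi m], the off-diagonal ones are small because [E]
    commutes with [N], and the real part of the [K] block is small by [re_near].
    The total is below [24 * t]. *)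
Lemma antisym_normal_near : cnorm (c - b) <= 90 * t.
Proof.
have [sQ QQ] := pQ; have [sQ' QQ'] := pQ'.
have [d1 d2] := off_diag; have [d1' d2'] := off_diag'.
(* Writing [K] as [K * (1 - Q)] exhibits [K * b * Q] as part of an off-diagonal
   block of [Q]. *)
have KQ : K * (1 - Q) = K.
  by rewrite mulrBr mulr1 !mulrBl mul1r QQ Q'Q0 subrr subr0 subr0.
have KQ' : K * (1 - Q') = K.
  by rewrite mulrBr mulr1 !mulrBl mul1r QQ' QQ'0 subr0 subrr subr0.
have sk : skew_part b = b - re_part b by rewrite [X in X - _]re_skew addrC addKr.
have e : c - b = (m - Q * b * Q) - (phi m + Q' * b * Q')
   - (Q * b * (1 - Q) + Q' * b * (1 - Q') + K * ((1 - Q) * b * Q)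
      + K * ((1 - Q') * b * Q') + K * re_part b * K).
  rewrite !(mulrA K) KQ KQ' /antisym_normal sk.
  rewrite -/X -/E -/F -/Q -/Q' -/U -/m -/K /K.
  by move: (phi m) m Q' Q b (re_part b) => *; ncring.
rewrite e; apply: le_trans (cnormB_bound (cnormB_bound m_near m'_near)
  (cnormD_bound (cnormD_bound (cnormD_bound (cnormD_bound d1 d1')
  (le_trans (cnormM_proj _ pK) d2)) (le_trans (cnormM_proj _ pK) d2')) re_near)) _.
move: ule qle qq tt t0; lra.
Qed.

End Construction.
End Core.

(** * C*-subalgebras fixed by symmetry maps *)

Section CStarSubalgebra.
Variables (R : realType) (A : cstarAlgType R).

(** Bundled, so that the structure of C*-algebra on the subtype can be inferred
    from the type alone. *)
Record cstar_subalgebra := CstarSubalgebra {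
  csub_set : set A;
  csub_closed : [/\ csub_set 1,
    forall (k : R[i]) a b, csub_set a -> csub_set b -> csub_set (k *: a + b) &
    forall a b, csub_set a -> csub_set b -> csub_set (a * b)];
  csub_star : forall a, csub_set a -> csub_set (star a);
  csub_limit : forall (u : nat -> A) l, (forall n, csub_set (u n)) ->
    cnorm (u n - l) @[n --> \oo] --> (0 : R) -> csub_set l
}.

Variable B : cstar_subalgebra.

Definition csub_pred : {pred A} := fun a => `[< csub_set B a >].

Lemma csub_predP a : reflect (csub_set B a) (a \in csub_pred).
Proof. exact: asboolP. Qed.

Lemma csub_subalg_closed : GRing.subalg_closed csub_pred.
Proof.
have [h1 hl hm] := csub_closed B.
split; first exact/csub_predP.
- by move=> k a b /csub_predP ha /csub_predP hb; apply/csub_predP/hl.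
- by move=> a b /csub_predP ha /csub_predP hb; apply/csub_predP/hm.
Qed.

HB.instance Definition _ := GRing.isSubalgClosed.Build R[i] A csub_pred csub_subalg_closed.

Definition csub_type := {a : A | a \in csub_pred}.

HB.instance Definition _ := SubType.on csub_type.
HB.instance Definition _ := Choice.on csub_type.
HB.instance Definition _ := [SubChoice_isSubAlgebra of csub_type by <:].


Local Notation W := csub_type.
Implicit Types u v : W.

Definition csub_star_op u : W :=
  exist _ (star (val u)) (introT (csub_predP _) (csub_star (elimT (csub_predP _) (valP u)))).

Lemma csub_complete (u : nat -> W) :
  (forall e : R, 0 < e -> exists N : nat,
     forall m n, (N <= m)%N -> (N <= n)%N -> cnorm (val (u m - u n)) < e) ->
  exists l : W, cnorm (val (u n - l)) @[n --> \oo] --> (0 : R).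
Proof.
move=> /cnorm_complete[l ul].
have /csub_predP Bl : csub_set B l.
  by apply: csub_limit ul => n; exact/csub_predP/valP.
by exists (exist _ l Bl : W).
Qed.

Lemma csub_starD u v : csub_star_op (u + v) = csub_star_op u + csub_star_op v.
Proof. by apply: val_inj; exact: starD. Qed.

Lemma csub_starZ (c : R[i]) u : csub_star_op (c *: u) = c^* *: csub_star_op u.
Proof. by apply: val_inj; exact: starZ. Qed.

Lemma csub_starM u v : csub_star_op (u * v) = csub_star_op v * csub_star_op u.
Proof. by apply: val_inj; exact: starM. Qed.

Lemma csub_starK u : csub_star_op (csub_star_op u) = u.
Proof. by apply: val_inj; exact: starK. Qed.

Lemma csub_norm_eq0 u : cnorm (val u) = 0 -> u = 0.
Proof. by move=> /cnorm_eq0 h; exact: val_inj. Qed.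

HB.instance Definition _ := isCStarAlgebra.Build R W
  csub_starD csub_starZ csub_starM csub_starK
  (fun u v => cnormD_le (val u) (val v))
  (fun c u => cnormZ c (val u))
  csub_norm_eq0
  (fun u v => cnormM_le (val u) (val v))
  (fun u => cnorm_star_mul (val u))
  csub_complete.

End CStarSubalgebra.

Section Equalizer.
Variables (R : realType) (A : vonNeumannAlgebra R).
Implicit Types (f g : A -> A) (a b : A).

Record hermitian_unital f : Prop := HermitianUnital {
  hu_add : forall a b, f (a + b) = f a + f b;
  hu_scale : forall (c : R[i]) a, f (c *: a) = c *: f a;
  hu_star : forall a, f (star a) = star (f a);
  hu_one : f 1 = 1;
  hu_wcvg : forall u l, wcvg u l -> wcvg (fun n => f (u n)) (f l)
}.

Lemma hermitian_unital_id : hermitian_unital id.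
Proof. by []. Qed.

Lemma hermitian_unital_comp f g : hermitian_unital f -> hermitian_unital g ->
  hermitian_unital (f \o g).
Proof.
move=> hf hg; split => /=.
- by move=> a b; rewrite (hu_add hg) (hu_add hf).
- by move=> c a; rewrite (hu_scale hg) (hu_scale hf).
- by move=> a; rewrite (hu_star hg) (hu_star hf).
- by rewrite (hu_one hg) (hu_one hf).
- by move=> u l ul; apply: (hu_wcvg hf); exact: (hu_wcvg hg).
Qed.

Lemma hermitian_unital_sym f : symmetry_map f -> clinear f -> weakly_continuous f ->
  hermitian_unital f.
Proof.
move=> sf lf wf; split; [exact: symmetry_add|exact: lf|exact: symmetry_star|
  exact: symmetry_one|exact: weakly_continuous_wcvg].
Qed.

(** The set where two maps of this kind agree is a C*-subalgebra, even when both
    reverse products: then [f (a * b) = f b * f a = g b * g a = g (a * b)]. *)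
Record parallel_maps f g : Prop := ParallelMaps {
  parallel_l : hermitian_unital f;
  parallel_r : hermitian_unital g;
  parallel_mul : (multiplicative_map f /\ multiplicative_map g) \/
                 (antimultiplicative_map f /\ antimultiplicative_map g)
}.

Variable P : (A -> A) -> (A -> A) -> Prop.
Hypothesis Ppar : forall f g, P f g -> parallel_maps f g.

Definition equalizer : set A := [set a | forall f g, P f g -> f a = g a].

Lemma equalizer_closed : [/\ equalizer 1,
    forall (k : R[i]) a b, equalizer a -> equalizer b -> equalizer (k *: a + b) &
    forall a b, equalizer a -> equalizer b -> equalizer (a * b)].
Proof.
split.
- by move=> f g /Ppar[hf hg _]; rewrite (hu_one hf) (hu_one hg).
- move=> k a b ha hb f g fg; have [hf hg _] := Ppar fg.
  by rewrite (hu_add hf) (hu_add hg) (hu_scale hf) (hu_scale hg) (ha _ _ fg) (hb _ _ fg).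
- move=> a b ha hb f g fg; have [_ _ [[mf mg]|[mf mg]]] := Ppar fg;
  by rewrite mf mg (ha _ _ fg) (hb _ _ fg).
Qed.

Lemma equalizer_star a : equalizer a -> equalizer (star a).
Proof.
move=> ha f g fg; have [hf hg _] := Ppar fg.
by rewrite (hu_star hf) (hu_star hg) (ha _ _ fg).
Qed.

(** Norm limits are weak limits, which both maps preserve. *)
Lemma equalizer_limit (u : nat -> A) l : (forall n, equalizer (u n)) ->
  cnorm (u n - l) @[n --> \oo] --> (0 : R) -> equalizer l.
Proof.
move=> hu /ncvg_wcvg ul f g fg; have [hf hg _] := Ppar fg.
apply: (wcvg_unique (hu_wcvg hf ul)).
have -> : (fun n => f (u n)) = (fun n => g (u n)) by apply/funext => n; exact: hu.
exact: hu_wcvg.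
Qed.

Definition equalizer_subalgebra : cstar_subalgebra A :=
  CstarSubalgebra equalizer_closed equalizer_star equalizer_limit.

(** [f b] is a left inverse and [g b] a right inverse of [f a = g a]. *)
Lemma equalizer_inverse a b : equalizer a -> a * b = 1 -> b * a = 1 -> equalizer b.
Proof.
move=> ha ab ba f g fg; have [hf hg mm] := Ppar fg.
have fba : f b * f a = 1.
  by case: mm => [[mf _]|[mf _]]; rewrite -mf ?ab ?ba (hu_one hf).
have gab : g a * g b = 1.
  by case: mm => [[_ mg]|[_ mg]]; rewrite -mg ?ab ?ba (hu_one hg).
by rewrite -[f b]mulr1 -gab mulrA -(ha _ _ fg) fba mul1r.
Qed.

Local Notation W := (csub_type equalizer_subalgebra).

Lemma csub_invertible (u : W) : invertible u <-> invertible (val u).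
Proof.
split=> [[v [uv vu]]|[b [ab ba]]].
  by exists (val v); split; [exact: (congr1 val uv)|exact: (congr1 val vu)].
have hb : equalizer b.
  apply: equalizer_inverse ab ba.
  exact: (elimT (csub_predP equalizer_subalgebra _) (valP u)).
exists (exist _ b (introT (csub_predP equalizer_subalgebra b) hb) : W).
by split; exact: val_inj.
Qed.

End Equalizer.

(** * Normal approximation with the symmetries in S *)

Section NormalApproximation.
Variables (R : realType) (eps1 eps2 : R -> R).
Hypotheses (hFR : FriisRordam eps1) (hLS : LoringSorensen eps2).
Variables (A : vonNeumannAlgebra R) (S : set (A -> A)).
Hypothesis hS : forall psi : A -> A, S psi ->
  [/\ symmetry_map psi, clinear psi & weakly_continuous psi].
Hypotheses (hadm : admissible S) (hTR : TR_rank1 S).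
Implicit Types (a b : A) (psi chi : A -> A).

Let hu psi : S psi -> hermitian_unital psi.
Proof. by move=> /hS[s l w]; exact: hermitian_unital_sym. Qed.

(** The fixed elements form a C*-subalgebra, whose stable rank is one by the
    density of the invertible elements. *)
Lemma normal_approx_mult a : (forall psi, S psi -> multiplicative_map psi) ->
  norm_contraction a -> symmetric_elements S a ->
  exists N, [/\ is_normal N, symmetric_elements S N &
                cnorm (N - a) <= eps1 (comm_norm a)].
Proof.
move=> mS a1 Sa.
pose P f g := S f /\ g = (id : A -> A).
have Ppar f g : P f g -> parallel_maps f g.
  move=> [Sf ->]; split; [exact: hu|exact: hermitian_unital_id|left].
  by split => //; exact: mS.
pose B := csub_type (equalizer_subalgebra Ppar).
have eqS b : equalizer P b <-> symmetric_elements S b.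
  by split=> [hb psi Spsi|hb f g [Sf ->]]; [exact: (hb psi id)|exact: hb].
pose lift b (Sb : symmetric_elements S b) : B :=
  exist _ b (introT (csub_predP (equalizer_subalgebra Ppar) b) (proj2 (eqS b) Sb)).
have valS (u : B) : symmetric_elements S (val u).
  by apply/eqS; exact: (elimT (csub_predP (equalizer_subalgebra Ppar) _) (valP u)).
have sr1 : stable_rank1 B.
  move=> u _ e e0; have [b [Sb ib] be] := hTR (valS u) e0.
  by exists (lift b Sb) => //; apply/csub_invertible.
have [N [nN Na]] := hFR sr1 (a := lift a Sa) a1.
exists (val N); split => //; exact: (congr1 val nN).
Qed.

(** Elements fixed by anti-multiplicative maps are not closed under products.
    Therefore take the C*-subalgebra where the multiplicative maps and
    [psi0 \o psi0] are the identity and every anti-multiplicative map agrees with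
    [psi0].  It is stable under [psi0], as [psi0] commutes with [S]; the
    restriction is an involution whose fixed elements are exactly the
    [S]-symmetric ones.  If that restriction is trivial, the subalgebra is
    commutative and [a] is normal. *)
Lemma normal_approx_anti a psi0 : S psi0 -> antimultiplicative_map psi0 ->
  (forall chi, S chi -> commuting_maps psi0 chi) ->
  norm_contraction a -> symmetric_elements S a -> ~ is_normal a ->
  exists N, [/\ is_normal N, symmetric_elements S N &
                cnorm (N - a) <= eps2 (comm_norm a)].
Proof.
move=> S0 anti0 comm0 a1 Sa na.
have [s0 l0 w0] := hS S0.
pose P f g := [\/ [/\ S f, multiplicative_map f & g = (id : A -> A)],
  [/\ S f, antimultiplicative_map f & g = psi0] | f = psi0 \o psi0 /\ g = id].
have Ppar f g : P f g -> parallel_maps f g.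
  move=> [[Sf mf ->]|[Sf mf ->]|[-> ->]].
  - by split; [exact: hu|exact: hermitian_unital_id|left].
  - by split; [exact: hu|exact: hu|right].
  - split; [by apply: hermitian_unital_comp; exact: hu|exact: hermitian_unital_id|left].
    by split=> // b c /=; rewrite !anti0.
pose B := csub_type (equalizer_subalgebra Ppar).
have inB (u : B) : equalizer P (val u).
  exact: (elimT (csub_predP (equalizer_subalgebra Ppar) _) (valP u)).
pose lift b (hb : equalizer P b) : B :=
  exist _ b (introT (csub_predP (equalizer_subalgebra Ppar) b) hb).
have eqS b : symmetric_elements S b <-> equalizer P b /\ psi0 b = b.
  split=> [Sb|[hb b0] psi Spsi].
    split; last exact: Sb.
    move=> f g [[Sf mf ->]|[Sf mf ->]|[-> ->]] /=; rewrite !Sb //.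
  have [sp _ _] := hS Spsi.
  have [mp|mp] := symmetry_mul sp; first by apply: (hb psi id); constructor 1.
  by rewrite (hb psi psi0) //; constructor 2.
have tauP (u : B) : equalizer P (psi0 (val u)).
  move=> f g [[Sf mf ->]|[Sf mf ->]|[-> ->]] /=.
  - by rewrite -comm0 // (inB u f id) //; constructor 1.
  - by rewrite -comm0 // (inB u f psi0) //; constructor 2.
  - by congr (psi0 _); apply: (inB u (psi0 \o psi0) id); constructor 3.
pose tau (u : B) : B := lift _ (tauP u).
have vtau u : val (tau u) = psi0 (val u) by [].
have tau_sym : symmetry_map tau.
  split.
  - by move=> u v; apply: val_inj; exact: symmetry_add.
  - by move=> r u; apply: val_inj; exact: symmetry_scale_real.
  - by move=> u; apply: val_inj; exact: symmetry_star.
  - move=> u nu /csub_invertible iu; apply: nu; apply/csub_invertible.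
    by apply: contrapT => /(symmetry_noninvertible s0).
  - by apply: val_inj; exact: symmetry_one.
  - by left=> c u; apply: val_inj; exact: l0.
  - by right=> u v; apply: val_inj; exact: anti0.
have tau_lin : clinear tau by move=> c u; apply: val_inj; exact: l0.
have tau_anti : antimultiplicative_map tau by move=> u v; apply: val_inj; exact: anti0.
have tau2 u : tau (tau u) = u.
  by apply: val_inj; apply: (inB u (psi0 \o psi0) id); constructor 3.
have [hEa a0] := proj1 (eqS a) Sa.
have [tau_id|tau_nid] := pselect (forall u, tau u = u).
  exfalso; apply: na; pose u := lift a hEa.
  have uv (v w : B) : v * w = w * v by rewrite -[LHS]tau_id tau_anti !tau_id.
  exact: (congr1 val (uv (star u) u)).
have otau : order_two tau.
  split=> //; apply: contrapT => h; apply: tau_nid => u.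
  by apply: contrapT => ne; apply: h; exists u.
have tr : TR_rank1 [set tau].
  move=> u hu' e e0.
  have Su : symmetric_elements S (val u).
    by apply/eqS; split; [exact: inB|exact: (congr1 val (hu' tau erefl))].
  have [b [Sb ib] be] := hTR Su e0.
  have [hb b0] := proj1 (eqS b) Sb.
  exists (lift b hb) => //; split; last exact/csub_invertible.
  by move=> _ ->; exact: val_inj.
have tau_a : tau (lift a hEa) = lift a hEa by exact: val_inj.
have [N [nN tN Na]] := hLS tau_sym tau_lin tau_anti otau tr (a := lift a hEa) a1 tau_a.
exists (val N); split => //; first exact: (congr1 val nN).
by apply/eqS; split; [exact: inB|exact: (congr1 val tN)].
Qed.

Lemma normal_approx a : norm_contraction a -> symmetric_elements S a -> ~ is_normal a ->
  exists N, [/\ is_normal N, symmetric_elements S N &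
    cnorm (N - a) <= Num.max (eps1 (comm_norm a)) (eps2 (comm_norm a))].
Proof.
move=> a1 Sa na.
have [mS|] := pselect (forall psi, S psi -> multiplicative_map psi).
  have [N [nN SN Na]] := normal_approx_mult mS a1 Sa.
  by exists N; split => //; rewrite le_max Na.
move=> /existsNP[psi /not_implyP[Spsi nm]].
have [sp lp _] := hS Spsi.
have ap : antimultiplicative_map psi by have [] := symmetry_mul sp.
have [||psi0 [S0 [_ anti0] comm0]] := hadm (t := (true, false)) _ Spsi; [by []|by []|].
have [N [nN SN Na]] := normal_approx_anti S0 anti0 comm0 a1 Sa na.
by exists N; split => //; rewrite le_max Na orbT.
Qed.

End NormalApproximation.

(** * The approximation theorem *)

Section StructuredApproximation.
Variables (R : realType) (A : vonNeumannAlgebra R) (S : set (A -> A)).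
Hypothesis hS : forall psi : A -> A, S psi ->
  [/\ symmetry_map psi, clinear psi & weakly_continuous psi].
Variable phi : A -> A.
Hypotheses (sphi : symmetry_map phi) (wphi : weakly_continuous phi).
Hypotheses (phi2 : forall a, phi (phi a) = a).
Hypothesis comm : forall psi, S psi -> commuting_maps phi psi.

(** Cut at [t := Num.sqrt e].  When [90 * t >= 1] the zero element is close
    enough, so the construction is only needed for small [t]. *)
Lemma antisymmetric_approx (b N : A) (e : R) : cnorm b <= 1 ->
  symmetric_elements S b -> antisymmetric_element phi b ->
  is_normal N -> symmetric_elements S N -> cnorm (N - b) <= e ->
  exists c, [/\ is_normal c, symmetric_elements S c, antisymmetric_element phi c &
                cnorm (c - b) <= 90 * Num.sqrt e].
Proof.
move=> b1 Sb phib Nn SN Nb.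
have e0 : 0 <= e by apply: le_trans Nb; exact: cnorm_ge0.
have [e00|ne0] := eqVneq e 0.
  have Nb0 : N = b.
    apply/eqP; rewrite -subr_eq0; apply/eqP/cnorm_eq0/eqP.
    by rewrite eq_le cnorm_ge0 andbT -e00.
  by exists b; rewrite subrr cnorm0 mulr_ge0 ?sqrtr_ge0 //; split => //; rewrite -Nb0.
have t0 : 0 < Num.sqrt e by rewrite sqrtr_gt0 lt_neqAle eq_sym ne0.
have [t1|t1] := leP (Num.sqrt e) 90^-1; last first.
  exists 0; split.
  - by rewrite /is_normal star0.
  - by move=> psi /hS[s _ _]; exact: sym0.
  - by rewrite /antisymmetric_element sym0 // oppr0.
  rewrite sub0r cnormN; apply: le_trans b1 _.
  by rewrite -ler_pdivrMl // mulr1 ltW.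
have Nb' : cnorm (N - b) <= Num.sqrt e ^+ 2 by rewrite sqr_sqrtr.
exists (antisym_normal phi b N (Num.sqrt e)); split.
- exact: antisym_normal_normal.
- move=> psi Spsi; have [sp _ wp] := hS Spsi.
  by apply: antisym_normal_fixed => //; [move=> a; exact: comm|exact: Sb|exact: SN].
- exact: antisym_normal_anti.
- exact: antisym_normal_near.
Qed.
End StructuredApproximation.

Theorem theorem7p3 (R : realType) (eps1 eps2 : R -> R)
  (heps1 : control_function eps1) (hFR : FriisRordam eps1)
  (heps2 : control_function eps2) (hLS : LoringSorensen eps2)
  (A : vonNeumannAlgebra R) (S : set (A -> A))
  (hS : forall psi : A -> A, S psi ->
        [/\ symmetry_map psi, clinear psi & weakly_continuous psi])
  (hadm : admissible S) (hTR : TR_rank1 S) :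
  let epsl := fun delta : R => Num.max (eps1 delta) (eps2 delta) in
  (forall phi : A -> A,
     symmetry_map phi -> conjugate_linear phi -> weakly_continuous phi ->
     order_two phi -> (forall psi, S psi -> commuting_maps phi psi) ->
     forall a : A, norm_contraction a -> symmetric_elements (S `|` [set phi]) a ->
     exists a'' : A,
       [/\ is_normal a'', symmetric_elements (S `|` [set phi]) a'' &
           cnorm (a'' - a) <= 90%:R * Num.sqrt (epsl (comm_norm a))])
  /\
  (forall phi : A -> A,
     symmetry_map phi -> clinear phi -> weakly_continuous phi ->
     order_two phi -> (forall psi, S psi -> commuting_maps phi psi) ->
     forall a : A, norm_contraction a -> symmetric_elements S a ->
     antisymmetric_element phi a ->
     exists a'' : A,
       [/\ is_normal a'', symmetric_elements S a'', antisymmetric_element phi a'' &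
           cnorm (a'' - a) <= 90%:R * Num.sqrt (epsl (comm_norm a))]).
Proof.
move=> epsl; split=> phi sphi lphi wphi [phi2 _] comm a a1; last first.
  move=> Sa pa; have [na|na] := pselect (is_normal a).
    by exists a; split => //; rewrite subrr cnorm0 mulr_ge0 ?sqrtr_ge0.
  have [N [nN SN Na]] := normal_approx hFR hLS hS hadm hTR a1 Sa na.
  exact: (antisymmetric_approx hS sphi wphi phi2 comm a1 Sa pa nN SN Na).
move=> Spa.
have Sa : symmetric_elements S a by move=> psi Spsi; apply: Spa; left.
have pa : phi a = a by apply: Spa; right.
have [na|na] := pselect (is_normal a).
  by exists a; split => //; rewrite subrr cnorm0 mulr_ge0 ?sqrtr_ge0.
have [N [nN SN Na]] := normal_approx hFR hLS hS hadm hTR a1 Sa na.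
(* Multiplication by ['i] exchanges the fixed elements of the conjugate-linear
   [phi] with the antisymmetric ones, and preserves [S]-symmetry. *)
have ni : complex.Re `|('i : R[i])| = 1 :> R by rewrite normCi.
have Si b : symmetric_elements S b -> symmetric_elements S ('i *: b).
  by move=> Sb psi Spsi; have [_ -> _] := hS _ Spsi; rewrite Sb.
have nZ (k : R[i]) (b : A) : is_normal b -> is_normal (k *: b).
  by rewrite /is_normal starZ -!scalerAl -!scalerAr !scalerA mulrC => ->.
have pia : antisymmetric_element phi ('i *: a).
  by rewrite /antisymmetric_element lphi conjCi pa scaleNr.
have Nia : cnorm ('i *: N - 'i *: a) <= epsl (comm_norm a).
  by rewrite -scalerBr cnormZ ni mul1r.
have ia1 : cnorm ('i *: a) <= 1 by rewrite cnormZ ni mul1r.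
have [c [nc Sc pc ca]] := antisymmetric_approx hS sphi wphi phi2 comm ia1
  (Si _ Sa) pia (nZ _ _ nN) (Si _ SN) Nia.
exists (- 'i *: c); split; first exact: nZ.
  move=> psi [Spsi|->].
    by have [_ -> _] := hS _ Spsi; rewrite Sc.
  by rewrite lphi rmorphN /= conjCi opprK pc scalerN scaleNr.
have -> : - 'i *: c - a = - 'i *: (c - 'i *: a).
  by rewrite scalerBr scalerA mulNr -expr2 sqrCi opprK scale1r.
by rewrite cnormZ normrN ni mul1r.
Qed.
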